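(* Let $\Omega\subset\mathbb{R}^3$ be open, bounded and connected with Lipschitz boundary. Let $\mathbf z\in W^{1,\infty}(\Omega;\mathbb{R}^3)$ be such that $$\nabla\mathbf z(\mathbf x)=\mathbf a(\mathbf x)\otimes\mathbf n(\mathbf x),\qquad\mathbf a\cdot\mathbf n=\mathfrak D-1\in\mathbb{R},\qquad\text{a.e. in }\Omega,$$ where $\mathfrak D$ is a constant. Then $\nabla\cdot(\mathbf n\otimes\mathbf a)=\mathbf 0$ in the sense of distributions. Furthermore, if $\mathbf n\in W^{1,1}(\Omega;\mathbb{R}^3)$ with $|\mathbf n|=1$ a.e. in $\Omega$, then $\nabla\cdot\mathbf a=0$ in the sense of distributions.
   Context: The divergence of a matrix field is taken row-wise: $(\nabla\cdot M)_i=\sum_j\partial_jM_{ij}$, so $(\nabla\cdot(\mathbf n\otimes\mathbf a))_i=\sum_j\partial_j(n_ia_j)$; $(\nabla\mathbf z)_{ij}=\partial_jz_i$. *)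

(* Defs.v *)
From HB Require Import structures.
From mathcomp Require Import all_boot all_order all_algebra.
From mathcomp Require Import all_classical all_reals all_analysis.

Set Implicit Arguments.
Unset Strict Implicit.
Unset Printing Implicit Defensive.

Import Order.TTheory GRing.Theory Num.Theory.
Import numFieldNormedType.Exports.

Local Open Scope classical_set_scope.
Local Open Scope ring_scope.

(* Points of R^3 are triples, so that Lebesgue measure is the library's product
   measure; values of vector fields are rows in 'rV[R]_3.  The norm of the
   library on both types is the sup norm: it is only used for topological
   notions and for Lipschitz continuity, which do not depend on the choice of
   the norm.  Lengths of vectors are measured with [enorm] below. *)
Notation R3 R := (R * R * R)%type.

Definition lebesgue3 (R : realType) :
    {measure set (measurableTypeR R * measurableTypeR R * measurableTypeR R)
       -> \bar R} :=
  ((@lebesgue_measure R \x @lebesgue_measure R)%E \x @lebesgue_measure R)%E.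

Definition row3 (R : realType) (x : R3 R) : 'rV[R]_3 :=
  \row_(i < 3) [:: x.1.1; x.1.2; x.2]`_i.

Definition basis3 (R : realType) (i : 'I_3) : R3 R :=
  ((i == 0%N :> nat)%:R, (i == 1%N :> nat)%:R, (i == 2%N :> nat)%:R).

Definition partial (R : realType) (i : 'I_3) (f : R3 R -> R) : R3 R -> R :=
  'D_(basis3 R i) f.

Definition dot (R : realType) (u v : 'rV[R]_3) : R :=
  \sum_(i < 3) u 0 i * v 0 i.

Definition enorm (R : realType) (u : 'rV[R]_3) : R := Num.sqrt (dot u u).

Definition outer (R : realType) (u v : 'rV[R]_3) : 'M[R]_3 :=
  \matrix_(i < 3, j < 3) (u 0 i * v 0 j).

(* Near each boundary point, Omega is, after a rotation or reflection Q of the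
   axes, the set of points lying above the graph of a Lipschitz function. *)
Definition Lipschitz_boundary (R : realType) (Omega : set (R3 R)) : Prop :=
  forall x0 : R3 R, (closure Omega `\` Omega°) x0 ->
  exists (Q : 'M[R]_3) (g : (R * R)%type -> R) (r : R),
    [/\ Q *m Q^T = 1%:M, lipschitz g, 0 < r &
      forall x : R3 R, ball x0 r x ->
        let y := row3 x *m Q in
        Omega x <-> g (y 0 0, y 0 1) < y 0 ord_max].

Definition partials (R : realType) (s : seq 'I_3) (f : R3 R -> R) :
    R3 R -> R :=
  foldr (@partial R) f s.

Definition smooth (R : realType) (f : R3 R -> R) : Prop :=
  forall s : seq 'I_3, continuous (partials s f) /\
    forall (i : 'I_3) (x : R3 R), derivable (partials s f) x (basis3 R i).

Definition test_function (R : realType) (Omega : set (R3 R))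
    (phi : R3 R -> R) : Prop :=
  let supp := closure [set x | phi x != 0] in
  [/\ smooth phi, compact supp & supp `<=` Omega].

Definition loc_integrable (R : realType) (Omega : set (R3 R))
    (f : R3 R -> R) : Prop :=
  forall K : set (R3 R), compact K -> K `<=` Omega ->
    (lebesgue3 R).-integrable K (EFin \o f).

(* Functions on Omega are represented by total functions on R^3, whose values
   outside Omega are ignored; \_ extends them by 0. *)
Definition in_Lp (R : realType) (Omega : set (R3 R)) (p : \bar R)
    (f : R3 R -> R) : Prop :=
  f \_ Omega \in Lfun (lebesgue3 R) p.

Definition weak_partial (R : realType) (Omega : set (R3 R)) (j : 'I_3)
    (f g : R3 R -> R) : Prop :=
  [/\ loc_integrable Omega f, loc_integrable Omega g &
    forall phi : R3 R -> R, test_function Omega phi ->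
      \int[lebesgue3 R]_(x in Omega) (f x * partial j phi x) =
      - \int[lebesgue3 R]_(x in Omega) (g x * phi x)].

Definition weak_gradient (R : realType) (Omega : set (R3 R))
    (z : R3 R -> 'rV[R]_3) (Dz : R3 R -> 'M[R]_3) : Prop :=
  forall i j : 'I_3,
    weak_partial Omega j (fun x => z x 0 i) (fun x => Dz x i j).

(* z belongs to W^{1,p}(Omega; R^3) and Dz is (a representative of) its
   gradient. *)
Definition in_W1p_with_gradient (R : realType) (Omega : set (R3 R))
    (p : \bar R) (z : R3 R -> 'rV[R]_3) (Dz : R3 R -> 'M[R]_3) : Prop :=
  [/\ weak_gradient Omega z Dz,
      forall i : 'I_3, in_Lp Omega p (fun x => z x 0 i) &
      forall i j : 'I_3, in_Lp Omega p (fun x => Dz x i j)].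

Definition in_W1p (R : realType) (Omega : set (R3 R)) (p : \bar R)
    (z : R3 R -> 'rV[R]_3) : Prop :=
  exists Dz : R3 R -> 'M[R]_3, in_W1p_with_gradient Omega p z Dz.

Definition measurable_field (R : realType) (Omega : set (R3 R))
    (v : R3 R -> 'rV[R]_3) : Prop :=
  forall i : 'I_3,
    measurable_fun
      (Omega : set (measurableTypeR R * measurableTypeR R * measurableTypeR R))
      (fun x => v x 0 i).

Definition distr_div (R : realType) (Omega : set (R3 R))
    (v : R3 R -> 'rV[R]_3) (phi : R3 R -> R) : R :=
  - \int[lebesgue3 R]_(x in Omega) (\sum_(j < 3) v x 0 j * partial j phi x).

(* Local integrability is what makes v define a distribution; without it the
   integrals in [distr_div] could be junk values. *)
Definition distr_div_eq0 (R : realType) (Omega : set (R3 R))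
    (v : R3 R -> 'rV[R]_3) : Prop :=
  (forall j : 'I_3, loc_integrable Omega (fun x => v x 0 j)) /\
  forall phi : R3 R -> R, test_function Omega phi -> distr_div Omega v phi = 0.

Definition distr_row_div_eq0 (R : realType) (Omega : set (R3 R))
    (M : R3 R -> 'M[R]_3) : Prop :=
  forall i : 'I_3, distr_div_eq0 Omega (fun x => row i (M x)).

(* Main.v *)
Require Import Defs.
From HB Require Import structures.
From mathcomp Require Import all_boot all_order all_algebra.
From mathcomp Require Import all_classical all_reals all_analysis.
From mathcomp Require Import measurable_realfun ess_sup_inf.
From mathcomp Require Import ring lra.
Import Order.TTheory GRing.Theory Num.Theory.
Import numFieldNormedType.Exports.
Local Open Scope classical_set_scope.
Local Open Scope ring_scope.

(** For fixed [i], [sum_j n_i a_j d_j phi = sum_j d_i z_j d_j phi] almost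
everywhere, and integrating by parts twice turns [int d_i z_j d_j phi] into
[int d_j z_j d_i phi], because second derivatives of [phi] commute.  Summing
over [j] gives [(D - 1) int d_i phi = 0].

If moreover [|n| = 1], then [a_j = sum_i n_i (n_i a_j)].  The fields
[n_i a] are bounded and divergence free and [n_i] is bounded and in W^{1,1}, so
the product rule gives [div a = sum_i grad n_i . (n_i a) =
a . grad (|n|^2 / 2) = 0].  The product rule (also used for [|n|^2]) is proved
by mollifying: one tests the divergence with [x |-> phi x * k (x - y)],
multiplies by [n_i y] and integrates over [y].  The limit uses that
[int int |f x - f y| k_m (x - y) -> 0] for integrable [f], and the mollifiers
[k_m] are obtained by rescaling the square of [phi] itself. *)

Set Implicit Arguments.
Unset Strict Implicit.

(** * Lebesgue measure on R^3 *)

(** Only the test functions have classical derivatives, and [n i * phi] is not a test function, so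
    the product rule cannot be had by inserting it; mollifying the test function rather than the
    fields avoids this. Integrability dictates how [a] is split: a priori [a] alone carries no
    bound, while the entries of the gradient of z are bounded and grad n is integrable, so the
    fields n_i a can be paired with grad n_i.

    The identity grad (|n|^2 / 2) = 0 is known only against smooth test functions, but it has to be
    multiplied by the merely bounded measurable [a]; this calls for a separate extension of the
    admissible multipliers. Using phi as a bump costs nothing: if it is 0 the identities are
    trivial, and otherwise it is a nonzero smooth function of compact support. That the integral of
    d_i phi vanishes rests on the translation invariance of Lebesgue measure.

    The gradients and n are replaced by representatives on the whole space that vanish off Omega,
    with bounds valid everywhere where bounds exist, so that Fubini and mollification need no
    domain. *)

Notation T3 R := (measurableTypeR R * measurableTypeR R * measurableTypeR R)%type.

Lemma product_sigma_finite d1 d2 (T1 : measurableType d1)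
    (T2 : measurableType d2) (R : realType)
    (m1 : {sigma_finite_measure set T1 -> \bar R})
    (m2 : {sigma_finite_measure set T2 -> \bar R}) :
  sigma_finite setT (m1 \x m2)%E.
Proof.
have /sigma_finiteP[F [TF ndF Foo]] := sigma_finiteT m1.
have /sigma_finiteP[G [TG ndG Goo]] := sigma_finiteT m2.
(* Both exhaustions are nondecreasing, so the rectangles with equal indices already cover the
   product. *)
exists (fun n => F n `*` G n) => [|k].
  apply/esym/seteqP; split => // -[x y] _.
  have [n _ Fx] : (\bigcup_i F i) x by rewrite -TF.
  have [m _ Gy] : (\bigcup_i G i) y by rewrite -TG.
  exists (maxn n m) => //; split => /=.
  - by move: x Fx; exact/subsetPset/ndF/leq_maxl.
  - by move: y Gy; exact/subsetPset/ndG/leq_maxr.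
have [mF Fk] := Foo k; have [mG Gk] := Goo k.
split; first exact: measurableX.
by rewrite product_measure1E// lte_mul_pinfty// ge0_fin_numE.
Qed.

(* The library's sigma-finite instance on products is shadowed by the one for
   subprobabilities. *)
Definition lebesgue2 (R : realType) :
    set (measurableTypeR R * measurableTypeR R) -> \bar R :=
  (@lebesgue_measure R \x @lebesgue_measure R)%E.
Arguments lebesgue2 : clear implicits.

HB.instance Definition _ (R : realType) := Measure.on (lebesgue2 R).
HB.instance Definition _ (R : realType) :=
  Measure_isSigmaFinite.Build _ _ _ (lebesgue2 R)
    (product_sigma_finite (@lebesgue_measure R) (@lebesgue_measure R)).

(** A second name for the same measure, to which sigma-finiteness is attached. It is convertible
    with [lebesgue3], so results obtained for it transfer as they stand. *)
Definition lebesgue3_sf (R : realType) : set (T3 R) -> \bar R := lebesgue3 R.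
Arguments lebesgue3_sf : clear implicits.

HB.instance Definition _ (R : realType) := Measure.copy (lebesgue3_sf R) (lebesgue3 R).
HB.instance Definition _ (R : realType) :=
  Measure_isSigmaFinite.Build _ _ _ (lebesgue3_sf R)
    (product_sigma_finite (lebesgue2 R) (@lebesgue_measure R)).

Section lebesgue3_theory.
Context {R : realType}.
Local Notation leb := (@lebesgue_measure R).
Local Notation mu := (lebesgue3 R).

Lemma measurable_box3 (A B C : set (measurableTypeR R)) :
  measurable A -> measurable B -> measurable C ->
  measurable (A `*` B `*` C : set (T3 R)).
Proof. by move=> mA mB mC; apply: measurableX => //; exact: measurableX. Qed.

Lemma lebesgue3_box (A B C : set (measurableTypeR R)) :
  measurable A -> measurable B -> measurable C ->
  mu (A `*` B `*` C) = (leb A * leb B * leb C)%E.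
Proof.
move=> mA mB mC.
have mAB : measurable (A `*` B) by exact: measurableX.
by rewrite -product_measure1E// -(product_measure1E (lebesgue2 R)).
Qed.

Lemma ball3E (x : R3 R) (e : R) :
  ball x e = ball x.1.1 e `*` ball x.1.2 e `*` ball x.2 e.
Proof.
by apply/seteqP; split => y; [move=> [[? ?] ?]|move=> [[? ?] ?]].
Qed.

Lemma measurable_ball3 (x : R3 R) (e : R) : measurable (ball x e : set (T3 R)).
Proof.
rewrite ball3E; apply: measurable_box3; exact: (open_measurable (ball_open _ _)).
Qed.

Lemma lebesgue3_ball (x : R3 R) (e : R) : 0 <= e ->
  mu (ball x e) = ((e *+ 2) ^+ 3)%:E.
Proof.
move=> e0; rewrite ball3E lebesgue3_box; [|exact: (open_measurable (ball_open _ _))..].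
by rewrite !lebesgue_measure_ball// -!EFinM !exprS expr0 mulr1 mulrA.
Qed.

(** An open set is the countable union of the balls with rational centre and radius 1/(n+1) that it
    contains. Radii below e / 2 keep such a ball, once it contains x, inside the ball of radius e
    about x. *)
Lemma open_measurable3 (U : set (R3 R)) : open U -> measurable (U : set (T3 R)).
Proof.
move=> oU.
pose q3 (q : rat * rat * rat) : R3 R := (ratr q.1.1, ratr q.1.2, ratr q.2).
pose I := [set i : (rat * rat * rat) * nat |
             ball (q3 i.1) (i.2.+1%:R^-1) `<=` U].
suff -> : U = \bigcup_(i in I) ball (q3 i.1) (i.2.+1%:R^-1).
  rewrite bigcup_mkcond; apply: countable_bigcupT_measurable => [|i].
    exact: countableP.
  by case: ifP => // _; exact: measurable_ball3.
apply/seteqP; split => [x Ux|x [i Ii /Ii//]].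
have /nbhs_ballP[e /= e0 eU] : nbhs x U by exact: open_nbhs_nbhs.
have [n n_e] : exists n, n.+1%:R^-1 < e / 2 :> R.
  have e20 : 0 < e / 2 by rewrite divr_gt0.
  by have [N _ /(_ N) NP] := near_infty_natSinv_lt (PosNum e20); exists N; apply: NP => /=.
have n0 : 0 < n.+1%:R^-1 :> R by rewrite invr_gt0.
have rd (t : R) : exists q : rat, ball (ratr q : R) (n.+1%:R^-1) t.
  have : t - n.+1%:R^-1 < t + n.+1%:R^-1 by rewrite ltrBlDr -addrA ltrDl addr_gt0.
  move=> /rat_in_itvoo[q]; rewrite in_itv/= => /andP[q1 q2]; exists q.
  move: q1 q2; rewrite /ball/= ltr_norml.
  move: (n.+1%:R^-1 : R) (ratr q : R) => c p q1 q2.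
  by apply/andP; split; lra.
have [q1 Hq1] := rd x.1.1; have [q2 Hq2] := rd x.1.2; have [q3' Hq3] := rd x.2.
have xq : ball (q3 (q1, q2, q3')) (n.+1%:R^-1) x by rewrite ball3E.
exists ((q1, q2, q3'), n) => //= y Hy; apply: eU.
apply: (@ball_split _ _ (q3 (q1, q2, q3'))).
  by apply: ball_sym; apply: (le_ball _ xq); exact: ltW.
by apply: (le_ball _ Hy); exact: ltW.
Qed.

Lemma compact_measurable3 (K : set (R3 R)) :
  compact K -> measurable (K : set (T3 R)).
Proof.
move=> cK; rewrite -(setCK K); apply: measurableC; apply: open_measurable3.
apply: closed_openC; apply: compact_closed cK.
exact: (@norm_hausdorff _ (R3 R)).
Qed.

Lemma preimage_generated (T U : Type) (f : T -> U) (G : set (set T))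
    (C : set (set U)) :
  (forall B, C B -> <<s G >> (f @^-1` B)) ->
  forall B, <<s C >> B -> <<s G >> (f @^-1` B).
Proof.
move=> CG B; pose S := [set B : set U | <<s G >> (f @^-1` B)].
suff : <<s C >> `<=` S by apply.
apply: smallest_sub => //.
have [s0 sC sU] := @smallest_sigma_algebra _ setT G.
split => [|A SA|F SF]; rewrite /S/=.
- by rewrite preimage_set0.
- by rewrite setTD preimage_setC -setTD; exact: sC.
- by rewrite preimage_bigcup; exact: sU.
Qed.

(** This is what lets a Dynkin induction on measurable sets start from the open ones. For the
    inclusion not given by [open_measurable3], the product sigma-algebra is generated by the
    coordinates, which are continuous. *)
Lemma measurable3_open : @measurable _ (T3 R) = <<s @open (R3 R) >>.
Proof.
apply/seteqP; split; last first.
  apply: smallest_sub; first exact: sigma_algebra_measurable.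
  by move=> U; exact: open_measurable3.
have coord (p : R3 R -> R) : continuous p -> forall B,
    @measurable _ (measurableTypeR R) B -> <<s @open (R3 R) >> (p @^-1` B).
  move=> cp; rewrite RGenOpens.measurableE; apply: preimage_generated.
  move=> _ [a [b ->]]; apply: sub_sigma_algebra.
  by move/continuousP : cp; apply; exact: interval_open.
have cfst (U V : topologicalType) (p : U * V) : {for p, continuous fst}.
  exact: cvg_fst.
have csnd (U V : topologicalType) (p : U * V) : {for p, continuous snd}.
  exact: cvg_snd.
apply: smallest_sub; first exact: smallest_sigma_algebra.
rewrite subUset; split => _ [B mB <-]; rewrite setTI; last first.
  by apply: coord mB => x; exact: csnd.
apply: preimage_generated mB => _ [] [C mC <-]; rewrite setTI -comp_preimage.
  apply: coord mC => x; apply: continuous_comp; exact: cfst.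
by apply: coord mC => x; apply: continuous_comp; [exact: cfst|exact: csnd].
Qed.

Lemma continuous_measurable3 (f : R3 R -> R) :
  continuous f -> measurable_fun setT (f : T3 R -> R).
Proof.
move=> /continuousP cf; apply: (measurability _ (RGenOpens.measurableE R)) => //.
move=> _ [_ [a [b ->] <-]]; rewrite setTI; apply: open_measurable3.
by apply: cf; exact: interval_open.
Qed.

(** * Translation invariance of Lebesgue measure *)

Lemma measurable_add1 (h : R) :
  measurable_fun setT ((fun x => x + h) : measurableTypeR R -> measurableTypeR R).
Proof. exact: measurable_funD. Qed.

(** The pushforward by the shift agrees with Lebesgue measure on half-open intervals, and these
    determine it. *)
Lemma lebesgue_measure_translate (h : R) (A : set (measurableTypeR R)) :
  measurable A -> leb ((fun x => x + h) @^-1` A) = leb A.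
Proof.
move=> mA; apply/esym.
pose shift := (fun x => x + h) : measurableTypeR R -> measurableTypeR R.
apply: (@lebesgue_measure_unique _ (pushforward leb shift)) => //.
- exact: measurable_add1.
- move=> ? _ [[a b] _ <-] /=; rewrite /pushforward.
  have -> : shift @^-1` `]a, b] = `]a - h, b - h]%classic.
    by apply/seteqP; split => x /=; rewrite !in_itv/= ltrBlDr lerBrDr.
  rewrite !lebesgue_measure_itv/= !lte_fin ltrD2r.
  by case: ifP => // _; rewrite -!EFinB; congr EFin; ring.
Qed.

Lemma measurable_add3 (h : R3 R) :
  measurable_fun setT ((fun x => x + h) : T3 R -> T3 R).
Proof.
have -> : (fun x => x + h) = (fun p : T3 R =>
    (p.1.1 + h.1.1, p.1.2 + h.1.2, p.2 + h.2)) by apply/funext => -[[? ?] ?].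
apply: measurable_fun_pair; [apply: measurable_fun_pair|].
- apply: measurable_funD => //.
  exact: (measurableT_comp measurable_fst measurable_fst).
- apply: measurable_funD => //.
  exact: (measurableT_comp measurable_snd measurable_fst).
- by apply: measurable_funD => //; exact: measurable_snd.
Qed.

(** The pushforward of the product measure has the right value on rectangles, so uniqueness of the
    product measure applies. *)
Lemma product_measure_preserving d1 d2 (T1 : measurableType d1)
    (T2 : measurableType d2) (m1 : {sigma_finite_measure set T1 -> \bar R})
    (m2 : {sigma_finite_measure set T2 -> \bar R}) (f : T1 -> T1)
    (g : T2 -> T2) :
  measurable_fun setT f -> measurable_fun setT g ->
  (forall A, measurable A -> m1 (f @^-1` A) = m1 A) ->
  (forall A, measurable A -> m2 (g @^-1` A) = m2 A) ->
  forall X, measurable X ->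
    (m1 \x m2)%E ((fun p => (f p.1, g p.2)) @^-1` X) = (m1 \x m2)%E X.
Proof.
move=> mf mg fP gP X mX; apply/esym.
have mfg : measurable_fun setT (fun p : T1 * T2 => (f p.1, g p.2)).
  apply: measurable_fun_pair; exact: measurableT_comp.
apply: (@product_measure_unique _ _ _ _ _ _ _
  (pushforward (m1 \x m2)%E (fun p => (f p.1, g p.2)))) => // A B mA mB.
change ((m1 \x m2)%E ((f @^-1` A) `*` (g @^-1` B)) = (m1 A * m2 B)%E).
have mfA : measurable (f @^-1` A) by rewrite -[X in measurable X]setTI; exact: mf.
have mgB : measurable (g @^-1` B) by rewrite -[X in measurable X]setTI; exact: mg.
by rewrite product_measure1E//; congr (_ * _)%E; [exact: fP|exact: gP].
Qed.

Lemma lebesgue3_translate (h : R3 R) (A : set (T3 R)) :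
  measurable A -> mu ((fun x => x + h) @^-1` A) = mu A.
Proof.
move=> mA.
pose F (q : measurableTypeR R * measurableTypeR R) :
  measurableTypeR R * measurableTypeR R := (q.1 + h.1.1, q.2 + h.1.2).
pose G (x : measurableTypeR R) : measurableTypeR R := x + h.2.
have mF : measurable_fun setT F.
  apply: measurable_fun_pair; apply: measurable_funD => //.
have FP B : measurable B -> lebesgue2 R (F @^-1` B) = lebesgue2 R B.
  exact: (@product_measure_preserving _ _ _ _ leb leb _ _ (measurable_add1 _)
    (measurable_add1 _) (lebesgue_measure_translate _)
    (lebesgue_measure_translate _)).
rewrite -[RHS](@product_measure_preserving _ _ _ _ (lebesgue2 R) leb F G mF
  (measurable_add1 _) FP (lebesgue_measure_translate _) A mA).
by congr (mu (_ @^-1` A)); apply/funext => -[[? ?] ?].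
Qed.

Lemma integral_translate3 (f : T3 R -> \bar R) (h : R3 R) :
  mu.-integrable setT f ->
  (\int[mu]_x f ((x : R3 R) + h)%R = \int[mu]_x f x)%E.
Proof.
move=> fi; have mf := measurable_int _ fi.
pose phi : T3 R -> T3 R := fun x => (x : R3 R) - h.
pose fh : T3 R -> \bar R := fun x => f ((x : R3 R) + h).
have mphi : measurable_fun setT phi := measurable_add3 (- h).
have mfh : measurable_fun setT fh := measurableT_comp mf (measurable_add3 h).
have fhK : fh \o phi = f by apply/funext => x; rewrite /fh/phi/= subrK.
transitivity (\int[pushforward mu phi]_x fh x)%E.
  apply: eq_measure_integral => A mA _; apply/esym.
  exact: lebesgue3_translate.
rewrite integral_pushforward ?fhK ?preimage_setT//.
Qed.

Lemma lebesgue3_bounded_lty (A : set (T3 R)) :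
  measurable A -> bounded_set (A : set (R3 R)) -> (mu A < +oo)%E.
Proof.
move=> mA [M [_ AM]]; set r := Num.max M 0 + 1.
have r0 : 0 < r by rewrite ltr_wpDl// le_max lexx orbT.
have Ar x : A x -> `|x : R3 R| <= r.
  by apply: AM; rewrite ltr_pwDr// le_max lexx.
apply: (@le_lt_trans _ _ (mu (ball (0 : R3 R) (r + 1)))).
  apply: le_measure; rewrite ?inE//; first exact: measurable_ball3.
  move=> x /Ar xr; rewrite -ball_normE/= sub0r normrN.
  by rewrite (le_lt_trans xr)// ltrDl.
by rewrite lebesgue3_ball ?ltry// addr_ge0// ltW.
Qed.

End lebesgue3_theory.

(** * Approximate identities *)

Section bounded_kernel.
Context d (T : measurableType d) (R : realType).
Variables (mu : {sigma_finite_measure set T -> \bar R}) (k : T * T -> R) (C : R).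
Hypotheses (mk : measurable_fun setT k) (kC : forall z, `|k z| <= C).
Variables f g : T -> R.
Hypotheses (gi : mu.-integrable setT (EFin \o g))
  (fi : mu.-integrable setT (EFin \o f)).

(** By Tonelli the modulus integrates to at most [C] times the product of the L1 norms of [g] and
    [f]. Every exchange of integrals against a kernel rests on this. *)
Lemma integrable_pair :
  (mu \x mu)%E.-integrable setT (fun z => (g z.1 * (f z.2 * k z))%:E).
Proof.
have mg : measurable_fun setT g by apply/measurable_EFinP; exact: measurable_int gi.
have mf : measurable_fun setT f by apply/measurable_EFinP; exact: measurable_int fi.
have mF : measurable_fun setT (fun z => (g z.1 * (f z.2 * k z))%:E).
  apply/measurable_EFinP; apply: measurable_funM; first exact: (measurableT_comp mg).
  by apply: measurable_funM => //; exact: (measurableT_comp mf).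
apply/integrable12ltyP => //=.
have /integrableP[_ gfin] := gi; have /integrableP[_ ffin] := fi.
have ffin' : (\int[mu]_y `|(f y)%:E| \is a fin_num)%E.
  by rewrite ge0_fin_numE//; exact: integral_ge0.
have C0 (z : T * T) : 0 <= C by apply: le_trans (kC z).
apply: (@le_lt_trans _ _ (\int[mu]_x (`|(g x)%:E| *
    (C%:E * \int[mu]_y `|(f y)%:E|)))%E).
  apply: ge0_le_integral => //.
  - by move=> x _; exact: integral_ge0.
  - have /measurable_fun_fubini_tonelli_F : measurable_fun setT
        (fun z => `|(g z.1 * (f z.2 * k z))%:E|)%E by exact: measurableT_comp.
    by apply.
  - apply: emeasurable_funM => //; apply: measurableT_comp => //.
    exact/measurable_EFinP.
  - move=> x _; rewrite -ge0_integralZl_EFin//; last 2 first.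
    + by apply: measurableT_comp => //; exact/measurable_EFinP.
    + exact: C0 (x, x).
    rewrite -ge0_integralZl//; last 2 first.
    + apply: measurable_funeM; apply: measurableT_comp => //.
      exact/measurable_EFinP.
    + by move=> y _; rewrite mule_ge0// lee_fin (C0 (x, x)).
    apply: ge0_le_integral => //.
    + apply/measurable_EFinP; apply: measurableT_comp => //.
      by apply/measurable_EFinP; exact: (measurable_fun_pair2 x mF).
    + do 2 apply: measurable_funeM; apply: measurableT_comp => //.
      exact/measurable_EFinP.
    + move=> y _; rewrite /= -!EFinM lee_fin !normrM.
      by rewrite ler_wpM2l// mulrC ler_wpM2r.
under eq_integral do rewrite muleC.
(* That [C] is nonnegative can only be read off at a point, so an empty [T] is treated apart. *)
have [[x0 _]|T0] := pselect (exists x0 : T, True); last first.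
  rewrite (_ : setT = set0) ?integral_set0 ?ltry//.
  by apply/seteqP; split => // x _; apply: T0; exists x.
have CI0 : (0 <= C%:E * \int[mu]_y `|(f y)%:E|)%E.
  by rewrite mule_ge0 ?lee_fin ?(C0 (x0, x0))//; exact: integral_ge0.
rewrite ge0_integralZl//; last first.
  by apply: measurableT_comp => //; exact/measurable_EFinP.
rewrite lte_mul_pinfty// fin_numM//.
Qed.

Let inner1 x : (\int[mu]_y (g x * (f y * k (x, y)))%:E)%E =
  (g x * \int[mu]_y (f y * k (x, y)))%:E.
Proof.
have fki : mu.-integrable setT (fun y => (f y * k (x, y))%:E).
  under eq_fun do rewrite EFinM.
  apply: integrableMl => //; first exact: (measurable_fun_pair2 x mk).
  exists C; split; first exact: num_real.
  by move=> D CD y _ /=; rewrite (le_trans (kC _))// ltW.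
under eq_integral do rewrite EFinM.
rewrite integralZl// [RHS]EFinM fineK//; exact: integrable_fin_num.
Qed.

Let inner2 y : (\int[mu]_x (g x * (f y * k (x, y)))%:E)%E =
  (f y * \int[mu]_x (g x * k (x, y)))%:E.
Proof.
have gki : mu.-integrable setT (fun x => (g x * k (x, y))%:E).
  under eq_fun do rewrite EFinM.
  apply: integrableMl => //; first exact: (measurable_fun_pair1 y mk).
  exists C; split; first exact: num_real.
  by move=> D CD x _ /=; rewrite (le_trans (kC _))// ltW.
under eq_integral do rewrite mulrCA EFinM.
rewrite integralZl// [RHS]EFinM fineK//; exact: integrable_fin_num.
Qed.

Lemma kernel_pairing :
  \int[mu]_x (g x * \int[mu]_y (f y * k (x, y))) =
  \int[(mu \x mu)%E]_z (g z.1 * (f z.2 * k z)).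
Proof.
rewrite /Rintegral -(integral12_prod_meas1 integrable_pair)/=; congr fine.
by apply: eq_integral => x _; rewrite /fubini_F/= inner1.
Qed.

Lemma kernel_pairingC :
  \int[mu]_x (g x * \int[mu]_y (f y * k (x, y))) =
  \int[mu]_y (f y * \int[mu]_x (g x * k (x, y))).
Proof.
rewrite kernel_pairing /Rintegral -(integral21_prod_meas1 integrable_pair)/=.
by congr fine; apply: eq_integral => y _; rewrite /fubini_G/= inner2.
Qed.

Lemma integrable_kernel_pairing :
  mu.-integrable setT (fun x => (g x * \int[mu]_y (f y * k (x, y)))%:E).
Proof.
have := integrable_fubini_F integrable_pair; rewrite /fubini_F/=.
by under eq_fun do rewrite inner1.
Qed.

End bounded_kernel.

(** * Kernels concentrating on the diagonal *)

Section approximate_identity.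
Import HBSimple.
Context d (T : measurableType d) (R : realType).
Variables (mu : {sigma_finite_measure set T -> \bar R}) (G : set (set T)).
Variable k : nat -> T * T -> R.
Hypotheses (GE : @measurable _ T = <<s G >>) (GI : setI_closed G).
Hypotheses (mk : forall n, measurable_fun setT (k n))
  (k0 : forall n z, 0 <= k n z) (ksym : forall n x y, k n (x, y) = k n (y, x))
  (k1 : forall n x, (\int[mu]_y (k n (x, y))%:E = 1)%E).
(** Concentration is only asked pointwise: the rank from which it holds may depend on [x] and [U],
    which dominated convergence tolerates. *)
Hypothesis kloc : forall U x, G U -> U x ->
  \forall n \near \oo, forall y, ~ U y -> k n (x, y) = 0.

Let mu2 : {measure set (T * T) -> \bar R} := (mu \x mu)%E.

(* Unlike the error of the mollification itself, [osc n f] is subadditive in [f]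
   and invariant under complements of indicator functions, so that its convergence
   to 0 can be proved by Dynkin induction. *)
Definition osc n (f : T -> R) : \bar R :=
  (\int[mu2]_z (`|f z.1 - f z.2| * k n z)%:E)%E.

Definition osc_cvg0 (f : T -> R) : Prop :=
  measurable_fun setT f /\
  forall e, 0 < e -> \forall n \near \oo, (osc n f <= e%:E)%E.

Let mfst (f : T -> R) : measurable_fun setT f ->
  measurable_fun setT (fun z : T * T => f z.1).
Proof. by move=> mf; exact: (measurableT_comp mf). Qed.

Let msnd (f : T -> R) : measurable_fun setT f ->
  measurable_fun setT (fun z : T * T => f z.2).
Proof. by move=> mf; exact: (measurableT_comp mf). Qed.

Let measurable_osc n (f : T -> R) : measurable_fun setT f ->
  measurable_fun setT (fun z : T * T => (`|f z.1 - f z.2| * k n z)%:E).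
Proof.
move=> mf; apply/measurable_EFinP; apply: measurable_funM => //.
apply: measurableT_comp => //.
by apply: measurable_funB; [exact: mfst|exact: msnd].
Qed.

Let osc_integrand_ge0 n (f : T -> R) (z : T * T) :
  (0 <= (`|f z.1 - f z.2| * k n z)%:E)%E.
Proof. by rewrite lee_fin mulr_ge0. Qed.

Lemma integral_kernel1 n (f : T -> R) :
  measurable_fun setT f -> (forall x, 0 <= f x) ->
  (\int[mu2]_z (f z.1 * k n z)%:E = \int[mu]_x (f x)%:E)%E.
Proof.
move=> mf f0; rewrite /mu2 fubini_tonelli1/=; last 2 first.
- by apply/measurable_EFinP; apply: measurable_funM => //; exact: mfst.
- by move=> z; rewrite lee_fin mulr_ge0.
apply: eq_integral => x _; rewrite /fubini_F/=.
under eq_integral do rewrite EFinM.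
rewrite ge0_integralZl_EFin// ?k1 ?mule1//.
- by move=> y _; rewrite lee_fin.
- by apply/measurable_EFinP; exact: (measurableT_comp (mk n)).
Qed.

(** Unit mass is assumed in the second variable; symmetry of the kernel transfers it to the
    first. *)
Lemma integral_kernel2 n (f : T -> R) :
  measurable_fun setT f -> (forall x, 0 <= f x) ->
  (\int[mu2]_z (f z.2 * k n z)%:E = \int[mu]_x (f x)%:E)%E.
Proof.
move=> mf f0; rewrite /mu2 fubini_tonelli2/=; last 2 first.
- by apply/measurable_EFinP; apply: measurable_funM => //; exact: msnd.
- by move=> z; rewrite lee_fin mulr_ge0.
apply: eq_integral => y _; rewrite /fubini_G/=.
under eq_integral do rewrite ksym EFinM.
rewrite ge0_integralZl_EFin// ?k1 ?mule1//.
- by move=> x _; rewrite lee_fin.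
- by apply/measurable_EFinP; exact: (measurableT_comp (mk n)).
Qed.

(** The bound does not depend on [n], so convergence of the oscillation to 0 passes to L1 limits. *)
Lemma osc_le n (f : T -> R) : measurable_fun setT f ->
  (osc n f <= \int[mu]_x `|f x|%:E + \int[mu]_x `|f x|%:E)%E.
Proof.
move=> mf; have mnf : measurable_fun setT (fun x => `|f x|).
  exact: measurableT_comp.
rewrite -{1}(integral_kernel1 n mnf)// -(integral_kernel2 n mnf)//.
rewrite -ge0_integralD//=; last 4 first.
- by move=> z _; rewrite lee_fin mulr_ge0.
- by apply/measurable_EFinP; apply: measurable_funM => //; exact: (mfst mnf).
- by move=> z _; rewrite lee_fin mulr_ge0.
- by apply/measurable_EFinP; apply: measurable_funM => //; exact: (msnd mnf).
apply: ge0_le_integral => //.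
- exact: measurable_osc.
- apply: emeasurable_funD; apply/measurable_EFinP; apply: measurable_funM => //.
  + exact: (mfst mnf).
  + exact: (msnd mnf).
- move=> z _; rewrite -EFinD lee_fin -mulrDl ler_wpM2r//.
  exact: ler_normB.
Qed.

Lemma oscD n (f g : T -> R) : measurable_fun setT f -> measurable_fun setT g ->
  (osc n (f \+ g)%R <= osc n f + osc n g)%E.
Proof.
move=> mf mg; rewrite -ge0_integralD//=; last 2 first.
- exact: measurable_osc.
- exact: measurable_osc.
apply: ge0_le_integral => //.
- by apply: measurable_osc; exact: measurable_funD.
- by apply: emeasurable_funD; exact: measurable_osc.
- move=> z _ /=; rewrite -EFinD lee_fin -mulrDl ler_wpM2r//.
  by rewrite opprD addrACA ler_normD.
Qed.

Lemma oscZ n (f : T -> R) c : measurable_fun setT f ->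
  osc n (fun x => c * f x) = (`|c|%:E * osc n f)%E.
Proof.
move=> mf; rewrite /osc -ge0_integralZl_EFin//; last exact: measurable_osc.
apply: eq_integral => z _.
by rewrite -EFinM mulrA -normrM mulrBr.
Qed.

Lemma osc_cvg0D f g : osc_cvg0 f -> osc_cvg0 g -> osc_cvg0 (f \+ g).
Proof.
move=> [mf f0] [mg g0]; split; first exact: measurable_funD.
move=> e e0; have e20 : 0 < e / 2 by rewrite divr_gt0.
near=> n; apply: (le_trans (oscD _ mf mg)).
rewrite (splitr e) EFinD; apply: leeD; near: n; [exact: f0|exact: g0].
Unshelve. all: end_near. Qed.

Lemma osc_cvg0Z f c : osc_cvg0 f -> osc_cvg0 (fun x => c * f x).
Proof.
move=> [mf f0]; split; first exact: measurable_funM.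
move=> e e0; have c0 : 0 < `|c| + 1 by rewrite ltr_wpDl.
near=> n; rewrite oscZ//.
apply: (@le_trans _ _ (`|c|%:E * (e / (`|c| + 1))%:E)%E).
  apply: lee_wpmul2l; first by rewrite lee_fin.
  by near: n; apply: f0; rewrite divr_gt0.
rewrite -EFinM lee_fin mulrCA ger_pMr// ler_pdivrMr// mul1r lerDl//.
Unshelve. all: end_near. Qed.

Lemma osc_cvg0_sum (I : Type) (s : seq I) (F : I -> T -> R) :
  (forall i, osc_cvg0 (F i)) -> osc_cvg0 (fun x => \sum_(i <- s) F i x).
Proof.
move=> HF; elim: s => [|i s IH].
  split => [|e e0].
    by under eq_fun do rewrite big_nil; exact: measurable_cst.
  near=> n; rewrite /osc; under eq_integral.
    move=> z _; rewrite !big_nil subrr normr0 mul0r; over.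
  by rewrite integral0 lee_fin ltW.
rewrite (_ : (fun x => _) = F i \+ (fun x => \sum_(j <- s) F j x)).
  exact: osc_cvg0D.
by apply/funext => x; rewrite big_cons.
Unshelve. all: end_near. Qed.

(** By [osc_le] the error [f - g] contributes at most twice its L1 norm, whatever [n]; hence the
    tolerance [e / 4], which leaves [e / 2] for [g]. *)
Lemma osc_cvg0_approx (f : T -> R) : measurable_fun setT f ->
  (forall e, 0 < e ->
     exists2 g : T -> R, osc_cvg0 g & (\int[mu]_x (`|f x - g x|%R)%:E <= e%:E)%E) ->
  osc_cvg0 f.
Proof.
move=> mf fg; split => // e e0.
have e40 : 0 < e / 4 by rewrite divr_gt0.
have e20 : 0 < e / 2 by rewrite divr_gt0.
have [g [mg g0] fge] := fg _ e40.
have mfg : measurable_fun setT (fun x => f x - g x) by exact: measurable_funB.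
near=> n.
have -> : f = g \+ (fun x => f x - g x) by apply/funext => x /=; rewrite addrC subrK.
apply: (le_trans (oscD _ mg mfg)).
rewrite (splitr e) EFinD; apply: leeD; first by near: n; exact: g0.
apply: (le_trans (osc_le _ mfg)).
rewrite (_ : e / 2 = e / 4 + e / 4); last by field.
by rewrite EFinD; exact: leeD.
Unshelve. all: end_near. Qed.

(** By symmetry the oscillation is twice the kernel mass sent from [A] to its complement. The mass
    [p n x] leaving a point [x] of [A] is eventually 0 by [kloc], and it is dominated by the
    indicator of [A], which is integrable. *)
Lemma osc_cvg0_indic_gen A : G A -> (mu A < +oo)%E -> osc_cvg0 (\1_A).
Proof.
move=> GA Afin; have mA : measurable A by rewrite GE; exact: sub_sigma_algebra.
have mCA : measurable (~` A) by exact: measurableC.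
split; first exact: measurable_indic.
pose p n x := (\int[mu]_y (\1_A x * (\1_(~` A) y * k n (x, y)))%:E)%E.
have mp1 n : measurable_fun setT
    (fun z : T * T => (\1_A z.1 * (\1_(~` A) z.2 * k n z))%:E).
  apply/measurable_EFinP; apply: measurable_funM.
    by apply: mfst; exact: measurable_indic.
  by apply: measurable_funM => //; apply: msnd; exact: measurable_indic.
have mp2 n : measurable_fun setT
    (fun z : T * T => (\1_A z.2 * (\1_(~` A) z.1 * k n z))%:E).
  apply/measurable_EFinP; apply: measurable_funM.
    by apply: msnd; exact: measurable_indic.
  by apply: measurable_funM => //; apply: mfst; exact: measurable_indic.
have i0 (B : set T) x : 0 <= (\1_B x : R) by rewrite indicE.
have i1 (B : set T) x : (\1_B x : R) <= 1 by rewrite indicE; case: (x \in B).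
have oscE n : osc n (\1_A) = (\int[mu]_x p n x + \int[mu]_x p n x)%E.
  rewrite /osc; under eq_integral.
    move=> z _.
    rewrite (_ : _ * _ = \1_A z.1 * (\1_(~` A) z.2 * k n z) +
       \1_A z.2 * (\1_(~` A) z.1 * k n z)); last first.
      rewrite !indicE !in_setC.
      case: (z.1 \in A); case: (z.2 \in A) => /=;
        rewrite ?subrr ?subr0 ?sub0r ?normrN ?normr0 ?normr1; ring.
    rewrite EFinD; over.
  rewrite ge0_integralD//; last 2 first.
  - by move=> z _; rewrite lee_fin !mulr_ge0.
  - by move=> z _; rewrite lee_fin !mulr_ge0.
  congr (_ + _)%E.
    by rewrite /mu2 fubini_tonelli1// => z; rewrite lee_fin !mulr_ge0.
  have p20 (z : T * T) : (0 <= (\1_A z.2 * (\1_(~` A) z.1 * k n z))%:E)%E.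
    by rewrite lee_fin !mulr_ge0.
  apply: (eq_trans (@fubini_tonelli2 _ _ _ _ _ mu mu _ (mp2 n) p20)).
  apply: eq_integral => y _; rewrite /fubini_G/p/=.
  by apply: eq_integral => x _; rewrite ksym.
have p0 n x : (0 <= p n x)%E.
  by apply: integral_ge0 => y _; rewrite lee_fin !mulr_ge0.
have p1 n x : (p n x <= (\1_A x)%:E)%E.
  apply: (@le_trans _ _ (\int[mu]_y ((\1_A x)%:E * (k n (x, y))%:E))%E).
    apply: ge0_le_integral => //.
    - by move=> y _; rewrite lee_fin !mulr_ge0.
    - exact: (measurable_fun_pair2 x (mp1 n)).
    - apply: measurable_funeM; apply/measurable_EFinP.
      exact: (measurableT_comp (mk n)).
    - move=> y _; rewrite -EFinM lee_fin ler_wpM2l// ler_piMl//.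
  rewrite ge0_integralZl_EFin// ?k1 ?mule1//.
  - by move=> y _; rewrite lee_fin.
  - by apply/measurable_EFinP; exact: (measurableT_comp (mk n)).
have pcvg : (\int[mu]_x p n x @[n --> \oo] --> \int[mu]_x (cst 0 x : \bar R))%E.
  have [//|//||||_ _ +] := @dominated_convergence _ _ _ mu setT measurableT p (cst 0%E)
    (fun x => (\1_A x)%:E).
  - move=> n; apply: (@measurable_fun_fubini_tonelli_F _ _ _ _ _ mu _ (mp1 n)) => z.
    by rewrite lee_fin !mulr_ge0.
  - apply: aeW => x _; apply: cvg_near_cst.
    have [Ax|nAx] := pselect (A x); last first.
      apply: nearW => n; rewrite /p; under eq_integral.
        move=> y _; rewrite indicE memNset// mul0r; over.
      by rewrite integral0.
    have := kloc GA Ax; apply: filterS => n kx.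
    rewrite /p; under eq_integral.
      move=> y _; rewrite (_ : _ * _ = 0); last first.
        rewrite [X in _ * (X * _)]indicE in_setC.
        have [yA|yA] := boolP (y \in A); first by rewrite mul0r mulr0.
        by rewrite kx ?mulr0// => /mem_set; exact/negP.
      over.
    by rewrite integral0.
  - apply/integrableP; split; first by apply/measurable_EFinP; exact: measurable_indic.
    under eq_integral do rewrite gee0_abs ?lee_fin//.
    by rewrite integral_indic// setIT.
  - by apply: aeW => x n _; rewrite gee0_abs.
  exact.
move: pcvg; rewrite integral0 => /fine_cvgP[] pfin /cvgrPdist_le pcvg e e0.
have e20 : 0 < e / 2 by rewrite divr_gt0.
near=> n; rewrite oscE (splitr e) EFinD.
have H : (\int[mu]_x p n x <= (e / 2)%:E)%E.
  rewrite -[X in (X <= _)%E]fineK; last by near: n; exact: pfin.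
  rewrite lee_fin.
  have : `|0 - fine (\int[mu]_x p n x)%E| <= e / 2 by near: n; exact: pcvg.
  by rewrite sub0r normrN; apply: le_trans; exact: ler_norm.
exact: leeD.
Unshelve. all: end_near. Qed.

(** Dynkin induction on the pi-system [G]. Intersecting with a fixed [Q] of finite measure keeps
    complements integrable: the indicator of [Q] minus [S] is a difference of two good functions. A
    countable disjoint union is the L1 limit of its finite parts, since the remainders decrease to
    the empty set within finite measure. *)
Lemma osc_cvg0_indic Q S : G Q -> (mu Q < +oo)%E -> measurable S ->
  osc_cvg0 (\1_(S `&` Q)).
Proof.
move=> GQ Qfin; have mG A : G A -> measurable A.
  by move=> GA; rewrite GE; exact: sub_sigma_algebra.
have mQ := mG _ GQ.
have fin A : measurable A -> (mu (A `&` Q) < +oo)%E.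
  move=> mA; apply: le_lt_trans Qfin; apply: le_measure; rewrite ?inE//.
  exact: measurableI.
rewrite GE; move: S.
apply: (@dynkin_induction _ T G (fun S => osc_cvg0 (\1_(S `&` Q)))) => //.
- by rewrite setTI; exact: osc_cvg0_indic_gen.
- move=> A GA; apply: osc_cvg0_indic_gen; first exact: GI.
  by apply: fin; exact: mG.
- move=> S mS PS.
  rewrite (_ : \1_(_ `&` Q) = \1_Q \+ (fun x => -1 * \1_(S `&` Q) x)).
    by apply: osc_cvg0D; [exact: osc_cvg0_indic_gen|exact: osc_cvg0Z].
  apply/funext => x /=; rewrite !indicE !in_setI in_setC.
  by case: (x \in S); case: (x \in Q) => /=; ring.
- move=> F mF tF PF.
  pose B m := \big[setU/set0]_(i < m) F i `&` Q.
  have mB m : measurable (B m).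
    by apply: measurableI => //; apply: bigsetU_measurable.
  have PB m : osc_cvg0 (\1_(B m)).
    elim: m => [|m IH].
      rewrite /B big_ord0 set0I; split; first exact: measurable_indic.
      move=> e e0; near=> n; rewrite /osc; under eq_integral.
        move=> z _; rewrite !indicE !in_set0 subrr normr0 mul0r; over.
      by rewrite integral0 lee_fin ltW.
    rewrite (_ : \1_(B m.+1) = \1_(B m) \+ \1_(F m `&` Q)); first exact: osc_cvg0D.
    apply/funext => x /=; rewrite /B big_ord_recr/= !indicE !in_setI in_setU.
    have disj : \big[setU/set0]_(i < m) F i `&` F m = set0.
      apply/seteqP; split => // y [+ Fmy].
      rewrite -bigcup_mkord => -[i /= im Fiy].
      have im' : i = m by apply: tF => //; exists y.
      by move: im; rewrite im' ltnn.
    have : x \in \big[setU/set0]_(i < m) F i `&` F m = false.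
      by rewrite disj in_set0.
    rewrite in_setI.
    by case: (x \in _); case: (x \in F m); case: (x \in Q) => //= _; rewrite ?addr0 ?add0r.
  set A := \bigcup_k F k `&` Q.
  have mA : measurable A by apply: measurableI => //; exact: bigcupT_measurable.
  have BA m : B m `<=` A.
    by apply: setSI; rewrite -bigcup_mkord => x [i _ Fx]; exists i.
  have cvgD : mu (A `\` B m) @[m --> \oo] --> 0%E.
    have -> : 0%E = mu (\bigcap_m (A `\` B m)).
      rewrite (_ : \bigcap_m _ = set0) ?measure0//.
      apply/seteqP; split => // x Dx; have [[i _ Fx] Qx] := (Dx 0%N I).1.
      have := (Dx i.+1 I).2; apply; split => //.
      by rewrite -bigcup_mkord; exists i => //=.
    apply: nonincreasing_cvg_mu.
    - apply: (@le_lt_trans _ _ (mu A)); last by apply: fin; exact: bigcupT_measurable.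
      by apply: le_measure; rewrite ?inE//; exact: measurableD.
    - by move=> m; exact: measurableD.
    - by apply: bigcapT_measurable => m; exact: measurableD.
    - move=> m n mn; apply/subsetPset; apply: setDS; apply: setSI.
      exact: subset_bigsetU.
  apply: osc_cvg0_approx; first exact: measurable_indic.
  move=> e e0.
  have [m me] : exists m, (mu (A `\` B m) <= e%:E)%E.
    move: cvgD => /fine_cvgP[] [N1 _ fN] /cvgrPdist_le/(_ e e0)[N2 _ N2e].
    exists (maxn N1 N2); rewrite -[leLHS]fineK; last by apply: fN; exact: leq_maxl.
    rewrite lee_fin; have /= := N2e (maxn N1 N2) (leq_maxr _ _).
    by rewrite sub0r normrN; apply: le_trans; exact: ler_norm.
  exists (\1_(B m)) => //.
  rewrite (eq_integral (fun x => (\1_(A `\` B m) x)%:E)); last first.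
    move=> x _; congr EFin; rewrite !indicE in_setD.
    have [xB|xB] := boolP (x \in B m).
      by rewrite (mem_set (BA _ _ (set_mem xB))) subrr normr0.
    by rewrite subr0; case: (x \in A); rewrite ?normr1 ?normr0.
  by rewrite integral_indic ?setIT//; exact: measurableD.
Unshelve. all: end_near. Qed.

(** Simple functions are L1-dense. Multiplying them by the indicator of [Q] brings them under
    [osc_cvg0_indic], and does not worsen the approximation because [f] vanishes off [Q]. *)
Lemma osc_cvg0_integrable Q (f : T -> R) : G Q -> (mu Q < +oo)%E ->
  mu.-integrable setT (EFin \o f) -> (forall x, ~ Q x -> f x = 0) ->
  osc_cvg0 f.
Proof.
move=> GQ Qfin fi fQ; have mf : measurable_fun setT f.
  by apply/measurable_EFinP; exact: measurable_int fi.
have mQ : measurable Q by rewrite GE; exact: sub_sigma_algebra.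
apply: osc_cvg0_approx => // e e0.
have [g [_ _ /fine_cvgP[] [N1 _ fN] /cvgrPdist_le/(_ e e0)[N2 _ N2e]]] :=
  approximation_sfun_integrable measurableT fi.
set N := maxn N1 N2.
have gN : (\int[mu]_x `|(f x)%:E - (g N x)%:E| <= e%:E)%E.
  rewrite -[leLHS]fineK; last by apply: fN; exact: leq_maxl.
  rewrite lee_fin; have /= := N2e N (leq_maxr _ _).
  by rewrite sub0r normrN; apply: le_trans; exact: ler_norm.
exists (fun x => g N x * \1_Q x).
  rewrite (_ : (fun x => _) = fun x => \sum_(y \in range (g N))
      (y * \1_(g N @^-1` [set y] `&` Q) x)); last first.
    apply/funext => x; rewrite {1}fimfunE !fsbig_finite//= mulr_suml.
    by apply: eq_bigr => y _; rewrite indicI/= mulrA.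
  under eq_fun do rewrite fsbig_finite//=.
  apply: osc_cvg0_sum => y; apply: osc_cvg0Z; apply: osc_cvg0_indic Qfin _ => //.
apply: le_trans gN; apply: ge0_le_integral => //.
- apply/measurable_EFinP; apply: measurableT_comp => //.
  apply: measurable_funB => //; apply: measurable_funM => //.
- apply: measurableT_comp => //.
  by apply: emeasurable_funB; apply/measurable_EFinP.
- move=> x _; rewrite -EFinB/= lee_fin indicE.
  have [xQ|xQ] := boolP (x \in Q); first by rewrite mulr1.
  by rewrite mulr0 fQ ?subr0 ?normr0// => /mem_set; exact/negP.
Qed.

Hypothesis kbd : forall n, exists C, forall z, `|k n z| <= C.

(** Since the kernel has unit mass, [g x * f x] is the integral over y of
    [g x * (f x * k n (x, y))]. The error is then the double integral of
    [g x * (f x - f y) * k n (x, y)], at most [M] times the oscillation of [f]. *)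
Lemma kernel_pairing_cvg (g f : T -> R) M : mu.-integrable setT (EFin \o g) ->
  mu.-integrable setT (EFin \o f) -> (forall x, `|g x| <= M) -> osc_cvg0 f ->
  \int[mu]_x (g x * \int[mu]_y (f y * k n (x, y))) @[n --> \oo] -->
  \int[mu]_x (g x * f x).
Proof.
move=> gi fi gM [mf fosc].
have mg : measurable_fun setT g by apply/measurable_EFinP; exact: measurable_int gi.
have gfi : mu.-integrable setT (fun x => (g x * f x)%:E).
  under eq_fun do rewrite EFinM.
  apply: integrableMr => //; exists M; split; first exact: num_real.
  by move=> D MD x _ /=; rewrite (le_trans (gM _))// ltW.
have mgf : measurable_fun setT (fun x => g x * f x) by exact: measurable_funM.
have Hi n : mu2.-integrable setT (fun z => (g z.1 * (f z.1 * k n z))%:E).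
  apply/integrableP; split.
    apply/measurable_EFinP; apply: measurable_funM; first exact: mfst.
    by apply: measurable_funM => //; exact: mfst.
  under eq_integral.
    move=> z _; rewrite /= mulrA normrM (ger0_norm (k0 _ _)); over.
  rewrite (@integral_kernel1 n (fun x => `|g x * f x|))//; last exact: measurableT_comp.
  by have /integrableP[] := gfi.
have HE n : \int[mu]_x (g x * f x) = \int[mu2]_z (g z.1 * (f z.1 * k n z)).
  rewrite /Rintegral -(integral12_prod_meas1 (Hi n))/=; congr fine.
  apply: eq_integral => x _; rewrite /fubini_F/=.
  under eq_integral do rewrite mulrA EFinM.
  rewrite integralZl ?k1 ?mule1//; apply/integrableP; split.
    by apply/measurable_EFinP; exact: (measurable_fun_pair2 x (mk n)).
  by under eq_integral do rewrite /= ger0_norm//; rewrite k1 ltry.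
apply/cvgrPdist_le => e e0.
(* The added 1 keeps the quotient meaningful when [M] is 0. *)
have e'0 : 0 < e / (`|M| + 1) by rewrite divr_gt0// ltr_wpDl.
near=> n.
have on : (osc n f <= (e / (`|M| + 1))%:E)%E by near: n; exact: fosc.
have [C kC] := kbd n.
rewrite (HE n) (kernel_pairing (mk n) kC)//.
have Fi := integrable_pair (mk n) kC gi fi.
rewrite -RintegralB; [|by []|exact: Hi|exact: Fi].
have FHi := integrableB measurableT (Hi n) Fi.
apply: le_trans (le_normr_Rintegral measurableT _) _.
  by move: FHi; apply: eq_integrable.
rewrite /Rintegral.
have H : (\int[mu2]_z `|g z.1 * (f z.1 * k n z) - g z.1 * (f z.2 * k n z)|%:E
    <= e%:E)%E.
  apply: (@le_trans _ _ (\int[mu2]_z (`|M|%:E * (`|f z.1 - f z.2| * k n z)%:E))%E).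
    apply: ge0_le_integral => //.
    - have /integrableP[mD _] := FHi.
      apply/measurable_EFinP; apply: measurableT_comp => //.
      exact/measurable_EFinP.
    - by apply: measurable_funeM; exact: measurable_osc.
    - move=> z _; rewrite -mulrBr -mulrBl !normrM (ger0_norm (k0 _ _)) -EFinM.
      rewrite lee_fin ler_wpM2r ?mulr_ge0// (le_trans (gM _))//.
      exact: ler_norm.
  rewrite ge0_integralZl_EFin//; last exact: measurable_osc.
  apply: (@le_trans _ _ (`|M|%:E * (e / (`|M| + 1))%:E)%E).
    by apply: lee_wpmul2l; rewrite ?lee_fin.
  rewrite -EFinM lee_fin mulrCA ger_pMr// ler_pdivrMr ?ltr_wpDl// mul1r.
  by rewrite lerDl.
rewrite -lee_fin fineK// ge0_fin_numE; last by apply: integral_ge0.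
by rewrite (le_lt_trans H)// ltry.
Unshelve. all: end_near. Qed.

End approximate_identity.

(** * Smooth functions *)

Section smooth_functions.
Context {R : realType}.
Implicit Types (f g : R3 R -> R) (x u v : R3 R).

Lemma partials_rcons s i f : partials s (partial i f) = partials (rcons s i) f.
Proof. by rewrite /partials -cats1 foldr_cat. Qed.

Lemma smooth_partial i f : smooth f -> smooth (partial i f).
Proof. by move=> fs s; rewrite partials_rcons; exact: fs. Qed.

Lemma smooth_continuous f : smooth f -> continuous f.
Proof. by move=> /(_ [::]) []. Qed.

Lemma smooth_derivable f i x : smooth f -> derivable f x (basis3 R i).
Proof. by move=> /(_ [::]) [_]; exact. Qed.

(** Iterated partials stay in [C], by induction on the list. Smoothness of products and rescalings
    thus reduces to naming a class stable under [partial], with no formula for higher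
    derivatives. *)
Lemma smooth_coind (C : (R3 R -> R) -> Prop) :
  (forall f, C f -> continuous f /\
     forall i, (forall x, derivable f x (basis3 R i)) /\ C (partial i f)) ->
  forall f, C f -> smooth f.
Proof.
move=> CP f Cf s; have : C (partials s f).
  by elim: s => [|i s IH] //=; have [_ /(_ i) []] := CP _ IH.
by move=> /CP[cf df]; split => // i x; have [] := df i.
Qed.

Lemma smooth_cst c : smooth (cst c : R3 R -> R).
Proof.
apply: (@smooth_coind (fun f => exists c, f = cst c)); last by exists c.
move=> _ [b ->]; split; first exact: cst_continuous.
move=> i; split => [x|]; first exact: derivable_cst.
by exists 0; apply/funext => x; rewrite /partial derive_cst.
Qed.

(** The derivative of a product is a sum of products, so products alone are not stable under
    [partial]; the algebra generated by the smooth functions is. *)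
Inductive smooth_alg : (R3 R -> R) -> Prop :=
| smooth_alg_base f : smooth f -> smooth_alg f
| smooth_alg_add f g : smooth_alg f -> smooth_alg g -> smooth_alg (f + g)
| smooth_alg_mul f g : smooth_alg f -> smooth_alg g -> smooth_alg (f * g).

Lemma smooth_alg_smooth f : smooth_alg f -> smooth f.
Proof.
apply: smooth_coind => {}f.
elim => {f}[f fs|f g af [cf IHf] ag [cg IHg]|f g af [cf IHf] ag [cg IHg]].
- split; first exact: smooth_continuous.
  move=> i; split; first by move=> x; exact: smooth_derivable.
  exact/smooth_alg_base/smooth_partial.
- split; first by move=> x; exact: cvgD (cf x) (cg x).
  move=> i; have [df Df] := IHf i; have [dg Dg] := IHg i.
  split=> [x|]; first exact: derivableD.
  rewrite (_ : partial i (f + g) = partial i f + partial i g).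
    exact: smooth_alg_add.
  by apply/funext => x; rewrite /partial deriveD.
- split; first by move=> x; exact: cvgM (cf x) (cg x).
  move=> i; have [df Df] := IHf i; have [dg Dg] := IHg i.
  split=> [x|]; first exact: derivableM.
  rewrite (_ : partial i (f * g) = f * partial i g + g * partial i f).
    by apply: smooth_alg_add; exact: smooth_alg_mul.
  by apply/funext => x; rewrite /partial deriveM.
Qed.

Lemma smoothD f g : smooth f -> smooth g -> smooth (fun x => f x + g x).
Proof.
move=> fs gs; apply: smooth_alg_smooth.
by apply: smooth_alg_add; exact: smooth_alg_base.
Qed.

Lemma smoothM f g : smooth f -> smooth g -> smooth (fun x => f x * g x).
Proof.
move=> fs gs; apply: smooth_alg_smooth.
by apply: smooth_alg_mul; exact: smooth_alg_base.
Qed.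

Lemma smoothZ c f : smooth f -> smooth (fun x => c * f x).
Proof. by move=> fs; apply: smoothM => //; exact: smooth_cst. Qed.

Lemma partialM i f g x : smooth f -> smooth g ->
  partial i (fun y => f y * g y) x = f x * partial i g x + g x * partial i f x.
Proof.
move=> fs gs; rewrite /partial (_ : (fun y => _) = f * g)//.
by rewrite deriveM//; exact: smooth_derivable.
Qed.

Lemma is_derive_line f u (p : R3 R) (t : R) : derivable f (t *: u + p) u ->
  is_derive t 1 (fun s : R => f (s *: u + p)) ('D_u f (t *: u + p)).
Proof.
move=> df.
have E : (fun h : R => h^-1 *: (((fun s : R => f (s *: u + p)) \o shift t) (h *: (1 : R))
            - f (t *: u + p))) =
         (fun h => h^-1 *: ((f \o shift (t *: u + p)) (h *: u) - f (t *: u + p))).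
  apply/funext => h /=; congr (_ *: (f _ - _)).
  by rewrite [h *: 1]mulr1 scalerDl addrA.
by apply: DeriveDef; rewrite /derivable /derive E.
Qed.

(** Only a directional derivative of [f] is at hand, not a differential. The chain rule is therefore
    applied in one real variable, along the line through [c *: x + b] after the rescaling h |-> c h,
    and the result is recognised as the difference quotient at [x]. *)
Lemma derive_affine f v c (b : R3 R) x : derivable f (c *: x + b) v ->
  is_derive x v (fun y => f (c *: y + b)) (c * 'D_v f (c *: x + b)).
Proof.
move=> df; set p := c *: x + b.
have L : is_derive (c * 0 : R) 1 (fun s : R => f (s *: v + p)) ('D_v f p).
  have := @is_derive_line f v p (c * 0); rewrite mulr0 scale0r add0r.
  by apply.
have M : is_derive (0 : R) 1 (fun h : R => c * h) c.
  have := @is_deriveZ _ _ _ id c (0 : R) (1 : R) 1 _.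
  by rewrite [_ *: 1]mulr1; apply.
pose F (y : R3 R) := f (c *: y + b).
have := is_derive1_comp L M; rewrite mulrC.
have -> : (fun s : R => f (s *: v + p)) \o (fun h : R => c * h) =
    (fun h : R => F (h *: v + x)).
  apply/funext => h /=; rewrite /F; congr f; rewrite /p scalerDr scalerA addrA//.
move=> H.
have E : (fun h : R => h^-1 *: (((fun t : R => F (t *: v + x)) \o shift 0) (h *: (1 : R))
            - F (0 *: v + x))) =
         (fun h => h^-1 *: ((F \o shift x) (h *: v) - F x)).
  apply/funext => h /=; rewrite scale0r add0r addr0.
  by rewrite [h *: 1]mulr1.
have := @ex_derive _ _ _ _ _ _ _ H; rewrite /derivable E => dF.
have := @derive_val _ _ _ _ _ _ _ H; rewrite /derive E => DF.
exact: DeriveDef.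
Qed.

Lemma smooth_affine f c (b : R3 R) : smooth f -> smooth (fun x => f (c *: x + b)).
Proof.
move=> fs.
(* The scalar [a] absorbs the factor [c] that each differentiation produces. *)
apply: (@smooth_coind (fun h => exists a g, smooth g /\
    h = (fun x => a * g (c *: x + b)))); last first.
  by exists 1, f; split => //; apply/funext => x; rewrite mul1r.
move=> _ [a [g [gs ->]]]; split.
  move=> x; apply: cvgM; first exact: cvg_cst.
  apply: (@continuous_comp _ _ _ (fun x : R3 R => c *: x + b) g); last first.
    exact: smooth_continuous.
  by apply: cvgD; [exact: (@scaler_continuous _ _ c x)|exact: cvg_cst].
move=> i.
have D x := derive_affine (smooth_derivable gs (i := i) (x := c *: x + b)).
split=> [x|].
  by apply: derivableM; [exact: derivable_cst|exact: (@ex_derive _ _ _ _ _ _ _ (D x))].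
exists (a * c), (partial i g); split; first exact: smooth_partial.
apply/funext => x.
rewrite /partial (_ : (fun y => _) = (cst a) * (fun x => g (c *: x + b)))//.
rewrite deriveM; [|exact: derivable_cst|exact: (@ex_derive _ _ _ _ _ _ _ (D x))].
by rewrite derive_cst scaler0 addr0 (@derive_val _ _ _ _ _ _ _ (D x)); exact: mulrA.
Qed.

Lemma partial_affine i f c (b : R3 R) x : smooth f ->
  partial i (fun y => f (c *: y + b)) x = c * partial i f (c *: x + b).
Proof.
move=> fs; have D := derive_affine (smooth_derivable fs (i := i) (x := c *: x + b)).
by rewrite /partial (@derive_val _ _ _ _ _ _ _ D).
Qed.

(** The mean value theorem is used twice: on the increment in direction [v] as a function along [u],
    then on ['D_u f] along [v]. The second difference on the left is symmetric in [u] and [v], which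
    is the source of [partialC]. *)
Lemma mixed_difference f u v x (s : R) :
  (forall y, derivable f y u) -> (forall y, derivable ('D_u f) y v) -> 0 < s ->
  exists c d : R, [/\ 0 <= c <= s, 0 <= d <= s &
    f (s *: u + (s *: v + x)) - f (s *: u + x) - (f (s *: v + x) - f x) =
    s ^+ 2 * 'D_v ('D_u f) (d *: v + (c *: u + x))].
Proof.
move=> du dvu s0.
pose g (t : R) := f (t *: u + (s *: v + x)) - f (t *: u + x).
have gd (t : R) : is_derive t 1 g
    ('D_u f (t *: u + (s *: v + x)) - 'D_u f (t *: u + x)).
  by apply: is_deriveB; apply: is_derive_line.
have cont (h dh : R -> R) : (forall t : R, is_derive t 1 h (dh t)) ->
    {within `[0, s], continuous h}.
  move=> hd; apply: derivable_within_continuous => t _.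
  exact: (@ex_derive _ _ _ _ _ _ _ (hd t)).
have [c cs gE] := MVT_segment (ltW s0) (fun t _ => gd t) (cont _ _ gd).
pose h (t : R) := 'D_u f (t *: v + (c *: u + x)).
have hd (t : R) : is_derive t 1 h ('D_v ('D_u f) (t *: v + (c *: u + x))).
  by apply: is_derive_line.
have [e es hE] := MVT_segment (ltW s0) (fun t _ => hd t) (cont _ _ hd).
exists c, e; split; [by move: cs; rewrite in_itv|by move: es; rewrite in_itv|].
move: gE; rewrite /g !scale0r !add0r subr0 => ->.
move: hE; rewrite /h !scale0r !add0r subr0.
rewrite addrCA => ->; by ring.
Qed.

(** Schwarz's theorem. Computing the same second difference in both orders gives points [p] and [q]
    near [x] with [A p = B q]; continuity of [A] and [B], with half of the supposed gap as
    tolerance, then gives a contradiction. *)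
Lemma partialC i j f x : smooth f ->
  partial i (partial j f) x = partial j (partial i f) x.
Proof.
move=> fs; apply/eqP/negPn/negP => ne.
pose A := partial i (partial j f); pose B := partial j (partial i f).
pose e := `|A x - B x|.
have e0 : 0 < e / 2 by rewrite divr_gt0// normr_gt0 subr_eq0.
have cA : continuous A by apply/smooth_continuous/smooth_partial/smooth_partial.
have cB : continuous B by apply/smooth_continuous/smooth_partial/smooth_partial.
have /nbhs_ballP[r1 /= r10 Ar] : \forall y \near x, `|A x - A y| < e / 2.
  by have /cvgrPdist_lt := cA x; apply.
have /nbhs_ballP[r2 /= r20 Br] : \forall y \near x, `|B x - B y| < e / 2.
  by have /cvgrPdist_lt := cB x; apply.
pose u := basis3 R i; pose v := basis3 R j.
pose r := Num.min r1 r2; have r0 : 0 < r by rewrite lt_min r10.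
(* This step length keeps every intermediate point of the mean value theorem within [r] of [x]. *)
pose s := r / (`|u| + `|v| + 1).
have n0 : 0 < `|u| + `|v| + 1 by rewrite ltr_wpDl// addr_ge0.
have s0 : 0 < s by rewrite divr_gt0.
have small c d : 0 <= c <= s -> 0 <= d <= s -> `|c *: u| + `|d *: v| < r.
  move=> /andP[c0 cs] /andP[d0 ds]; rewrite !normrZ !ger0_norm//.
  apply: (@le_lt_trans _ _ (s * (`|u| + `|v|))).
    by rewrite mulrDr lerD// ler_wpM2r.
  by rewrite /s mulrAC ltr_pdivrMr// ltr_pM2l// ltrDl.
have [c [d [cs ds E1]]] := @mixed_difference f v u x s
  (fun y => smooth_derivable fs (i := j) (x := y))
  (fun y => smooth_derivable (@smooth_partial j f fs) (i := i) (x := y)) s0.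
have [c' [d' [cs' ds' E2]]] := @mixed_difference f u v x s
  (fun y => smooth_derivable fs (i := i) (x := y))
  (fun y => smooth_derivable (@smooth_partial i f fs) (i := j) (x := y)) s0.
set p := d *: u + (c *: v + x) in E1; set q := d' *: v + (c' *: u + x) in E2.
have pB : ball x r p.
  rewrite -ball_normE/= /p addrA addrC opprD addNKr normrN.
  by apply: le_lt_trans (ler_normD _ _) _; exact: small.
have qB : ball x r q.
  rewrite -ball_normE/= /q addrA addrC opprD addNKr normrN.
  by apply: le_lt_trans (ler_normD _ _) _; rewrite addrC; exact: small.
have pq : A p = B q.
  have s20 : s ^+ 2 != 0 by rewrite expf_neq0// gt_eqF.
  have E1' : s ^+ 2 * A p = _ := esym E1.
  have E2' : s ^+ 2 * B q = _ := esym E2.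
  have vu : s *: v + (s *: u + x) = s *: u + (s *: v + x) := addrCA _ _ _.
  have swap (y1 y2 y3 y4 : R) : y1 - y2 - (y3 - y4) = y1 - y3 - (y2 - y4) by ring.
  by apply: (mulfI s20); rewrite E1' E2' vu; exact: swap.
have Ap : `|A x - A p| < e / 2 by apply: (Ar p (le_ball _ pB)); rewrite ge_min lexx.
have Bq : `|B x - B q| < e / 2.
  by apply: (Br q (le_ball _ qB)); rewrite ge_min lexx orbT.
move: Ap Bq; rewrite pq /e; clear; move: (A x) (B x) (B q) => y1 y2 y3 H1 H2.
by have := ler_distD y3 y1 y2; rewrite (distrC y3 y2); lra.
Qed.

End smooth_functions.

(** * Test functions and mollifiers *)

Section test_functions.
Context {R : realType}.
Local Notation mu := (lebesgue3 R).
Implicit Types (f g phi : R3 R -> R) (K Omega : set (R3 R)).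

Lemma compact_support_bounded f K : continuous f -> compact K ->
  (forall x, ~ K x -> f x = 0) -> exists M, forall x, `|f x| <= M.
Proof.
move=> cf cK f0.
have /compact_bounded[M [_ HM]] : compact (f @` K).
  by apply: continuous_compact => //; exact: continuous_subspaceT.
exists (Num.max (M + 1) 0) => x; rewrite le_max.
have [Kx|nKx] := pselect (K x).
  by apply/orP; left; apply: HM; rewrite ?ltrDl//; exists x.
by rewrite f0// normr0 lexx orbT.
Qed.

Lemma bounded_support_integrable (f : T3 R -> R) (A : set (T3 R)) M :
  measurable_fun setT f -> measurable A -> (mu A < +oo)%E ->
  (forall x, `|f x| <= M) -> (forall x, ~ A x -> f x = 0) ->
  mu.-integrable setT (EFin \o f).
Proof.
move=> mf mA Afin fM f0.
apply: (@le_integrable _ _ _ _ _ measurableT _ (fun x => M%:E * (\1_A x)%:E)%E).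
- exact/measurable_EFinP.
- move=> x _; rewrite /= lee_fin indicE.
  have [/set_mem Ax|/negP nAx] := boolP (x \in A).
    by rewrite mulr1 (le_trans (fM x))// ler_norm.
  by rewrite mulr0 f0 ?normr0// => /mem_set.
- apply: integrableZl => //; apply/integrableP; split.
    by apply/measurable_EFinP; exact: measurable_indic.
  under eq_integral do rewrite gee0_abs ?lee_fin//.
  by rewrite integral_indic// setIT.
Qed.

Lemma compact_lty K : compact K -> (mu K < +oo)%E.
Proof.
move=> cK; apply: lebesgue3_bounded_lty; first exact: compact_measurable3.
exact: compact_bounded.
Qed.

Lemma compact_support_integrable f K : continuous f -> compact K ->
  (forall x, ~ K x -> f x = 0) -> mu.-integrable setT (EFin \o f).
Proof.
move=> cf cK f0; have [M fM] := compact_support_bounded cf cK f0.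
apply: (bounded_support_integrable _ _ _ fM f0).
- exact: continuous_measurable3.
- exact: compact_measurable3.
- exact: compact_lty.
Qed.

Lemma compact_closed3 K : compact K -> closed K.
Proof. by apply: compact_closed; exact: (@norm_hausdorff _ (R3 R)). Qed.

Lemma partial_support i f K : closed K ->
  (forall x, ~ K x -> f x = 0) -> forall x, ~ K x -> partial i f x = 0.
Proof.
move=> cK f0 x Kx; rewrite /partial (@near_eq_derive _ _ _ f (cst 0)).
  by rewrite derive_cst.
have /open_nbhs_nbhs : open_nbhs x (~` K) by split => //; exact: closed_openC.
by apply: filterS => y /f0.
Qed.

Lemma test_function_support Omega phi : test_function Omega phi ->
  exists K, [/\ compact K, K `<=` Omega & forall x, ~ K x -> phi x = 0].
Proof.
move=> [_ cK KO]; exists (closure [set x | phi x != 0]); split => // x Kx.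
by apply/eqP/negPn/negP => px; apply: Kx; exact: subset_closure.
Qed.

Lemma test_functionP Omega phi K : smooth phi -> compact K -> K `<=` Omega ->
  (forall x, ~ K x -> phi x = 0) -> test_function Omega phi.
Proof.
move=> sphi cK KO phi0; have clK := compact_closed3 cK.
have SK : closure [set x | phi x != 0] `<=` K.
  rewrite [X in _ `<=` X](closure_id K).1//; apply: closure_subset => x /= px.
  by apply: contrapT => /phi0 p0; rewrite p0 eqxx in px.
split => //; last exact: subset_trans KO.
exact: (subclosed_compact (@closed_closure _ _) cK).
Qed.

Lemma test_functionM Omega phi g : test_function Omega phi -> smooth g ->
  test_function Omega (fun x => phi x * g x).
Proof.
move=> tphi sg; have [K [cK KO phi0]] := test_function_support tphi.
apply: (test_functionP _ cK KO); first by apply: smoothM => //; case: tphi.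
by move=> x /phi0 ->; rewrite mul0r.
Qed.

(** The difference quotients [D n] have integral 0 by translation invariance. They converge to the
    partial derivative, and dominated convergence applies: the mean value theorem bounds them by the
    supremum of the derivative, and their supports lie in a fixed ball. *)
Lemma integral_partial0 i f K : smooth f -> compact K ->
  (forall x, ~ K x -> f x = 0) -> \int[mu]_x partial i f x = 0.
Proof.
move=> sf cK f0; set e := basis3 R i.
have cf := smooth_continuous sf.
have fi := compact_support_integrable cf cK f0.
have [r0 [_ Kr0]] := compact_bounded cK; pose r := `|r0|.
have Kr x : K x -> `|x| <= r + 1.
  by apply: Kr0; rewrite (le_lt_trans (ler_norm _))// ltrDl.
have [M pM] := compact_support_bounded (smooth_continuous (@smooth_partial _ i f sf)) cK
  (@partial_support i f K (compact_closed3 cK) f0).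
pose h n : R := n.+1%:R^-1.
have h0 n : 0 < h n by rewrite invr_gt0.
have h1 n : h n <= 1 by rewrite invf_le1// ler1n.
pose D n : T3 R -> R := fun x => (h n)^-1 * (f ((x : R3 R) + h n *: e) - f x).
(* Points of [K] have norm at most [r + 1], the shifts have norm at most that of [e] because
   [h n <= 1], and the last 1 makes the inequality strict. *)
pose A : set (T3 R) := ball (0 : R3 R) (r + 1 + `|e| + 1).
have mf : measurable_fun setT (f : T3 R -> R) by exact: continuous_measurable3.
have mD n : measurable_fun setT (D n).
  apply: measurable_funM => //; apply: measurable_funB => //.
  exact: (measurableT_comp mf (measurable_add3 _)).
have DM n x : `|D n x| <= M.
  have gd (t : R) : is_derive t 1 (fun t : R => f (t *: e + x)) (partial i f (t *: e + x)).
    by apply: is_derive_line; exact: smooth_derivable.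
  have [|c _] := MVT_segment (ltW (h0 n)) (fun t _ => gd t).
    apply: derivable_within_continuous => t _.
    exact: (@ex_derive _ _ _ _ _ _ _ (gd t)).
  rewrite scale0r add0r subr0 => E.
  rewrite /D [(x : R3 R) + _]addrC E mulrC mulfK ?gt_eqF//.
have D0 n x : ~ A x -> D n x = 0.
  move=> Ax; rewrite /D !f0 ?subrr ?mulr0// => [Kx|Kx]; apply: Ax.
    rewrite /A -ball_normE/= sub0r normrN.
    have xr := Kr _ Kx.
    by rewrite (le_lt_trans xr)// -addrA ltrDl ltr_wpDl.
  rewrite /A -ball_normE/= sub0r normrN.
  have xr := Kr _ Kx.
  rewrite -(addrK (h n *: e) x) (le_lt_trans (ler_normB _ _))//.
  apply: (@le_lt_trans _ _ (r + 1 + `|e|)); last by rewrite ltrDl.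
  by rewrite lerD// normrZ ger0_norm ?ler_piMl// ltW.
have mA : measurable A by exact: measurable_ball3.
have Afin : (mu A < +oo)%E 
  by rewrite /A lebesgue3_ball ?ltry// !addr_ge0 ?normr_ge0.
have Di n : mu.-integrable setT (EFin \o D n).
  exact: (bounded_support_integrable (mD n) mA Afin (DM n) (D0 n)).
have intD n : (\int[mu]_x (D n x)%:E = 0)%E.
  rewrite /D; under eq_integral do rewrite EFinM EFinB.
  have fti : mu.-integrable setT (fun x => (f ((x : R3 R) + h n *: e))%:E).
    rewrite (_ : (fun x => _) = fun x => (h n)%:E * (D n x)%:E + (f x)%:E)%E.
      apply: (integrableD measurableT); last exact: fi.
      exact: (integrableZl measurableT _ (Di n)).
    apply/funext => x; rewrite -EFinM -EFinD /D mulrA mulfV ?gt_eqF// mul1r.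
    by rewrite subrK.
  rewrite integralZl//; last exact: integrableB.
  rewrite integralB//= (integral_translate3 (f := EFin \o f)) ?subee ?mule0//.
  exact: integrable_fin_num.
have Dcvg (x : T3 R) : (D n x)%:E @[n --> \oo] --> (partial i f x)%:E.
  apply: cvg_EFin; first exact: nearW.
  rewrite (_ : fine \o _ =
      (fun t : R => t^-1 *: (f (t *: e + x) - f x)) \o h); last first.
    by apply/funext => n; rewrite /= /D [_ + x]addrC.
  apply: (@cvg_comp _ _ _ h _ _ (0^')); last first.
    exact: (smooth_derivable sf (i := i) (x := x)).
  move=> B HB.
  have : \forall n \near \oo, h n != 0 -> B (h n) := @cvg_harmonic R _ HB.
  by apply: filterS => n; apply; rewrite gt_eqF.
have [|||||_ _ +] := @dominated_convergence _ _ _ mu setT measurableT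
  (fun n x => (D n x)%:E) (fun x => (partial i f x)%:E) (fun x => (M%:E * (\1_A x)%:E)%E).
- by move=> n; exact/measurable_EFinP.
- apply/measurable_EFinP; apply: continuous_measurable3.
  exact/smooth_continuous/smooth_partial.
- by apply: aeW => x _; exact: Dcvg.
- apply: integrableZl => //; apply/integrableP; split.
    by apply/measurable_EFinP; exact: measurable_indic.
  under eq_integral do rewrite gee0_abs ?lee_fin//.
  by rewrite integral_indic// setIT.
- apply: aeW => x n _; rewrite /= lee_fin indicE.
  have [_|/negP nAx] := boolP (x \in A); first by rewrite mulr1.
  by rewrite mulr0 D0 ?normr0// => /mem_set.
rewrite (_ : [sequence _]_n = cst 0%E); last by apply/funext => n; exact: intD.
by move=> /(cvg_lim (@ereal_hausdorff R)); rewrite lim_cst// /Rintegral => <-.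
Qed.

(** Near each point of [K] all small enough margins work, namely those below half the radius of a
    ball contained in Omega; compactness makes this uniform over [K]. *)
Lemma compact_margin K Omega : compact K -> open Omega -> K `<=` Omega ->
  exists2 d, 0 < d & forall x h, K x -> `|h| < d -> Omega (x + h).
Proof.
move=> /compact_near_coveringP cK oO KO.
have := @cK R (0^'+) (fun d x => forall h : R3 R, `|h| < d -> Omega (x + h)) _.
have H : forall x, K x -> \forall x' \near x & i \near 0^'+,
    (fun d x => forall h : R3 R, `|h| < d -> Omega (x + h)) i x'.
  move=> x Kx; have /nbhs_ballP[r /= r0 rO] : nbhs x Omega.
    by apply: open_nbhs_nbhs; split => //; exact: KO.
  have r20 : 0 < r / 2 by rewrite divr_gt0.
  exists (ball x (r / 2), [set d | d < r / 2]) => /=.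
    split; first exact: nbhsx_ballx.
    exact: nbhs_right_lt.
  move=> [y d] /= [xy dr] h hd; apply: rO; rewrite -ball_normE/= opprD addrA.
  rewrite (le_lt_trans (ler_normB _ _))// [ltRHS]splitr ltrD//.
    by move: xy; rewrite -ball_normE.
  exact: lt_trans dr.
(* Every margin strictly between 0 and [d] is admissible; [d / 2] is one of them. *)
move=> /(_ _ H) [d /= d0 Hd]; exists (d / 2); first by rewrite divr_gt0.
move=> x h Kx hd; apply: (Hd (d / 2)) => //=.
  by rewrite sub0r normrN gtr0_norm ?divr_gt0// ltr_pdivrMr// ltr_pMr// ltr1n.
by rewrite divr_gt0.
Qed.

Lemma integral_pos f K x0 : continuous f -> compact K ->
  (forall x, ~ K x -> f x = 0) -> (forall x, 0 <= f x) -> 0 < f x0 ->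
  0 < \int[mu]_x f x.
Proof.
move=> cf cK f0 fpos fx0.
have fi := compact_support_integrable cf cK f0.
have f20 : 0 < f x0 / 2 by rewrite divr_gt0.
have /nbhs_ballP[r /= r0 Br] : \forall y \near x0, `|f x0 - f y| < f x0 / 2.
  by have /cvgrPdist_lt := cf x0; apply.
apply: fine_gt0; apply/andP; split; last first.
  have := integrable_fin_num measurableT fi.
  by rewrite ge0_fin_numE//; apply: integral_ge0 => x _; rewrite lee_fin.
apply: (@lt_le_trans _ _ (\int[mu]_x ((f x0 / 2)%:E * (\1_(ball x0 r) x)%:E))%E).
  have mB := @measurable_ball3 R x0 r.
  rewrite ge0_integralZl_EFin//; last 2 first.
  - by apply/measurable_EFinP; exact: measurable_indic.
  - exact: ltW.
  rewrite integral_indic// setIT lebesgue3_ball ?(ltW r0)// -EFinM lte_fin.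
  by rewrite mulr_gt0// exprn_gt0// mulrn_wgt0.
apply: ge0_le_integral => //.
- by move=> x _; rewrite mule_ge0// lee_fin// ltW.
- apply: measurable_funeM; apply/measurable_EFinP; apply: measurable_indic.
  exact: measurable_ball3.
- by apply/measurable_EFinP; exact: continuous_measurable3.
- move=> x _; rewrite -EFinM lee_fin indicE.
  have [/set_mem xB|_] := boolP (x \in _); last by rewrite mulr0.
  have := Br _ xB; rewrite mulr1 ltr_distlC => /andP[+ _].
  rewrite {1}(splitr (f x0)) addrK; exact: ltW.
Qed.

(** The kernel is phi(a h)^2 + phi(-a h)^2, normalised: squares give the sign, the sum of the two
    reflections gives evenness. Scaling about the origin by 1/a, with a = (r + 1) / d, carries the
    ball of radius [r] containing [K] inside that of radius [d], wherever [K] lies in it. The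
    integral is positive because phi does not vanish at [x0]. *)
Lemma mollifier_exists phi K x0 d : smooth phi -> compact K ->
  (forall x, ~ K x -> phi x = 0) -> phi x0 != 0 -> 0 < d ->
  exists k : R3 R -> R,
    [/\ smooth k, (forall h, 0 <= k h), (forall h, k (- h) = k h),
      \int[mu]_h k h = 1 &
      exists C, [/\ compact C, (forall h, C h -> `|h| < d) &
        forall h, ~ C h -> k h = 0]].
Proof.
move=> sphi cK phi0 px0 d0.
have [M [_ KM]] := compact_bounded cK.
pose r := Num.max (M + 1) 1; have r0 : 0 < r by rewrite lt_max ltr01 orbT.
have Kr x : K x -> `|x| <= r.
  by apply: KM; rewrite lt_max ltrDl ltr01.
pose a := (r + 1) / d; have a0 : 0 < a by rewrite divr_gt0// addr_gt0.
pose q (h : R3 R) := phi (a *: h + 0) * phi (a *: h + 0)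
  + phi ((- a) *: h + 0) * phi ((- a) *: h + 0).
have sq : smooth q.
  by apply: smoothD; apply: smoothM; exact: smooth_affine.
have q0 h : 0 <= q h by rewrite addr_ge0// -expr2 sqr_ge0.
have qN h : q (- h) = q h by rewrite /q !scalerN !scaleNr opprK addrC.
pose C := (fun x : R3 R => a^-1 *: x) @` K `|`
  (fun x : R3 R => (- a)^-1 *: x) @` K.
have cC : compact C.
  apply: compactU; apply: continuous_compact => //; apply: continuous_subspaceT;
    exact: scaler_continuous.
have Cd h : C h -> `|h| < d.
  have rd : a^-1 * r < d.
    by rewrite invf_div mulrAC ltr_pdivrMr ?addr_gt0// ltr_pM2l// ltrDl.
  move=> [[x Kx <-]|[x Kx <-]]; apply: le_lt_trans rd.
    by rewrite normrZ gtr0_norm ?invr_gt0// ler_pM2l ?invr_gt0//; exact: Kr.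
  rewrite invrN scaleNr normrN.
  by rewrite normrZ gtr0_norm ?invr_gt0// ler_pM2l ?invr_gt0//; exact: Kr.
have qC h : ~ C h -> q h = 0.
  move=> nC; rewrite /q !addr0 !phi0 ?mulr0 ?addr0//.
    move=> Kh; apply: nC; right; exists (- a *: h) => //.
    by rewrite scalerA mulVf ?oppr_eq0 ?gt_eqF// scale1r.
  move=> Kh; apply: nC; left; exists (a *: h) => //.
  by rewrite scalerA mulVf ?gt_eqF// scale1r.
have I0 : 0 < \int[mu]_h q h.
  apply: (@integral_pos q C (a^-1 *: x0)) => //; first exact: smooth_continuous.
  rewrite /q !addr0 scalerA mulfV ?gt_eqF// scale1r ltr_pwDl//.
    by rewrite -expr2 exprn_even_gt0.
  by rewrite -expr2 sqr_ge0.
have qi := compact_support_integrable (smooth_continuous sq) cC qC.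
exists (fun h => (\int[mu]_h q h)^-1 * q h); split.
- exact: smoothZ.
- by move=> h; rewrite mulr_ge0// invr_ge0 ltW.
- by move=> h; rewrite qN.
- by rewrite RintegralZl// mulVf// gt_eqF.
- by exists C; split => // h /qC ->; rewrite mulr0.
Qed.

End test_functions.

(** * Product rule for weak derivatives *)

Section Rintegral_extra.
Context d (T : measurableType d) (R : realType) (mu : {measure set T -> \bar R}).

Lemma Rintegral_eq0 (f : T -> R) : (forall x, f x = 0) -> \int[mu]_x f x = 0.
Proof.
move=> f0; rewrite /Rintegral; under eq_integral do rewrite f0.
by rewrite integral0.
Qed.

Lemma integrable_Rsum (I : Type) (s : seq I) (f : I -> T -> R) :
  (forall i, mu.-integrable setT (EFin \o f i)) ->
  mu.-integrable setT (EFin \o (fun x => \sum_(i <- s) f i x)).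
Proof.
move=> fi; have := @integrable_sum _ _ _ mu setT measurableT I s xpredT
  (fun i x => (f i x)%:E) (fun i _ => fi i).
by apply: eq_integrable => // x _ /=; rewrite sumEFin.
Qed.

Lemma Rintegral_sum (I : Type) (s : seq I) (f : I -> T -> R) :
  (forall i, mu.-integrable setT (EFin \o f i)) ->
  \int[mu]_x (\sum_(i <- s) f i x) = \sum_(i <- s) \int[mu]_x f i x.
Proof.
move=> fi; elim: s => [|i s IH].
  by rewrite big_nil; apply: Rintegral_eq0 => x; rewrite big_nil.
rewrite big_cons -IH -RintegralD//; last exact: integrable_Rsum.
by apply: eq_Rintegral => x _; rewrite big_cons.
Qed.

Lemma integrable_mulr_bounded (f c : T -> R) M :
  mu.-integrable setT (EFin \o f) -> measurable_fun setT c ->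
  (forall x, `|c x| <= M) -> mu.-integrable setT (EFin \o (fun x => f x * c x)).
Proof.
move=> fi mc cM.
have : mu.-integrable setT ((EFin \o f) \* (EFin \o c))%E.
  apply: integrableMl => //; exists M; split; first exact: num_real.
  by move=> D CD y _ /=; rewrite (le_trans (cM _))// ltW.
exact: eq_integrable.
Qed.

End Rintegral_extra.

Lemma cvg_sumr (R : realType) (I : Type) (s : seq I) (u : I -> nat -> R) (l : I -> R) :
  (forall i, u i n @[n --> \oo] --> l i) ->
  (\sum_(i <- s) u i n) @[n --> \oo] --> \sum_(i <- s) l i.
Proof.
move=> ul; elim: s => [|i s IH].
  by rewrite big_nil; under eq_fun do rewrite big_nil; exact: cvg_cst.
by rewrite big_cons; under eq_fun do rewrite big_cons; exact: cvgD.
Qed.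

(** * Mollification on R^3 and the product rule *)

Section mollification.
Context {R : realType}.
Local Notation mu := (lebesgue3 R).

(** Evenness makes the convolution kernel symmetric, as the approximate identities require. *)
Definition mollifiers (kappa : nat -> R3 R -> R) : Prop := forall n,
  [/\ smooth (kappa n), (forall h, 0 <= kappa n h),
      (forall h, kappa n (- h) = kappa n h), \int[mu]_h kappa n h = 1 &
      exists C, [/\ compact C, (forall h, C h -> `|h| < n.+1%:R^-1) &
        forall h, ~ C h -> kappa n h = 0]].

Lemma mollifiers_exist (phi : R3 R -> R) K x0 : smooth phi -> compact K ->
  (forall x, ~ K x -> phi x = 0) -> phi x0 != 0 ->
  exists kappa, mollifiers kappa.
Proof.
move=> sphi cK phi0 px0.
have d0 n : 0 < n.+1%:R^-1 :> R by rewrite invr_gt0.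
have [kappa Hk] := choice (fun n => mollifier_exists sphi cK phi0 px0 (d0 n)).
by exists kappa.
Qed.

Definition conv_kernel (k : R3 R -> R) (z : T3 R * T3 R) : R :=
  k ((z.1 : R3 R) - (z.2 : R3 R)).

Lemma measurable_conv_kernel (k : R3 R -> R) : continuous k ->
  measurable_fun setT (conv_kernel k).
Proof.
move=> /continuous_measurable3 mk.
suff msub : measurable_fun setT (fun z : T3 R * T3 R => (z.1 : R3 R) - z.2 : T3 R).
  exact: (measurableT_comp mk msub).
have m1 : measurable_fun setT (fst : T3 R * T3 R -> T3 R) by exact: measurable_fst.
have m2 : measurable_fun setT (snd : T3 R * T3 R -> T3 R) by exact: measurable_snd.
have mff : measurable_fun setT (fun x : T3 R => x.1.1).
  exact: (measurableT_comp measurable_fst measurable_fst).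
have mfs : measurable_fun setT (fun x : T3 R => x.1.2).
  exact: (measurableT_comp measurable_snd measurable_fst).
have ms : measurable_fun setT (fun x : T3 R => x.2) by exact: measurable_snd.
have -> : (fun z : T3 R * T3 R => (z.1 : R3 R) - z.2) = (fun z =>
    (z.1.1.1 - z.2.1.1, z.1.1.2 - z.2.1.2, z.1.2 - z.2.2)).
  by apply/funext => -[[[? ?] ?] [[? ?] ?]].
apply: measurable_fun_pair; first apply: measurable_fun_pair.
- apply: measurable_funB; [exact: (measurableT_comp mff m1)|
    exact: (measurableT_comp mff m2)].
- apply: measurable_funB; [exact: (measurableT_comp mfs m1)|
    exact: (measurableT_comp mfs m2)].
- apply: measurable_funB; [exact: (measurableT_comp ms m1)|
    exact: (measurableT_comp ms m2)].
Qed.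

Section conv_fubini.
Variables (k : R3 R -> R) (C : R) (f g : T3 R -> R).
Hypotheses (ck : continuous k) (kC : forall h, `|k h| <= C).
Hypotheses (fi : mu.-integrable setT (EFin \o f))
  (gi : mu.-integrable setT (EFin \o g)).

Lemma conv_fubini :
  \int[mu]_y (f y * \int[mu]_x (g x * k ((x : R3 R) - y))) =
  \int[mu]_x (g x * \int[mu]_y (f y * k ((x : R3 R) - y))).
Proof.
exact/esym/(@kernel_pairingC _ _ _ (lebesgue3_sf R) (conv_kernel k) C
  (measurable_conv_kernel ck) (fun z => kC _) f g gi fi).
Qed.

Lemma integrable_conv :
  mu.-integrable setT (EFin \o (fun y => f y * \int[mu]_x (g x * k ((x : R3 R) - y)))).
Proof.
(* In [integrable_kernel_pairing] the inner integral runs over the second argument of the kernel,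
   here over the first; hence the reflected kernel. *)
have ck' : continuous (fun h : R3 R => k (- h)).
  by move=> x; apply: continuous_comp; [exact: opp_continuous|exact: ck].
have := @integrable_kernel_pairing _ _ _ (lebesgue3_sf R)
  (conv_kernel (fun h : R3 R => k (- h))) C
  (measurable_conv_kernel ck') (fun z => kC _) g f fi gi.
apply: eq_integrable => // y _ /=; congr (f y * _)%:E.
by apply: eq_Rintegral => x _; rewrite /conv_kernel/= opprB.
Qed.

Lemma integrable_conv_inner y :
  mu.-integrable setT (EFin \o (fun x => g x * k ((x : R3 R) - y))).
Proof.
apply: (integrable_mulr_bounded gi _ (M := C)) => [|x]; last exact: kC.
have mk := continuous_measurable3 ck.
exact: (measurableT_comp mk (measurable_add3 (- y))).
Qed.
End conv_fubini.

Lemma mollifier_bounded kappa n : mollifiers kappa ->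
  exists C, forall h, `|kappa n h| <= C.
Proof.
move=> /(_ n) [sk _ _ _ [C [cC _ kC]]].
exact: compact_support_bounded (smooth_continuous sk) cC kC.
Qed.

Section mollify_cvg.
Variables (kappa : nat -> R3 R -> R) (Omega : set (R3 R)).
Hypotheses (mkappa : mollifiers kappa) (oOmega : open Omega)
  (Omega_fin : (mu Omega < +oo)%E).
Variables (f g : T3 R -> R) (M : R).
Hypotheses (fi : mu.-integrable setT (EFin \o f))
  (gi : mu.-integrable setT (EFin \o g)).
Hypotheses (gM : forall x, `|g x| <= M) (f0 : forall x, ~ Omega x -> f x = 0).

(** An instance of [kernel_pairing_cvg]. The open sets form the generating pi-system, and Omega,
    open and of finite measure, is the set off which [f] vanishes. *)
Lemma mollify_cvg :
  \int[mu]_x (g x * \int[mu]_y (f y * kappa n ((x : R3 R) - y))) @[n --> \oo]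
  --> \int[mu]_x (g x * f x).
Proof.
pose k n := conv_kernel (kappa n).
have mk n : measurable_fun setT (k n).
  by apply: measurable_conv_kernel; have [/smooth_continuous] := mkappa n.
have k0 n z : 0 <= k n z by have [_ + _ _ _] := mkappa n; apply.
have ksym n x y : k n (x, y) = k n (y, x).
  by have [_ _ kN _ _] := mkappa n; rewrite /k /conv_kernel/= -kN opprB.
have k1 n x : (\int[lebesgue3_sf R]_y (k n (x, y))%:E = 1)%E.
  have [sk kp kN kI [C [cC _ kC]]] := mkappa n.
  have ki := compact_support_integrable (smooth_continuous sk) cC kC.
  transitivity (\int[mu]_y (EFin \o kappa n) ((y : R3 R) + - x)%R)%E.
    by apply: eq_integral => y _; rewrite ksym.
  rewrite integral_translate3// -[LHS]fineK; first by congr EFin.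
  exact: integrable_fin_num.
have kloc U (x : R3 R) : open U -> U x ->
    \forall n \near \oo, forall y, ~ U y -> k n (x, y) = 0.
  move=> oU Ux; have /nbhs_ballP[e /= e0 eU] : nbhs x U.
    by apply: open_nbhs_nbhs.
  have := near_infty_natSinv_lt (PosNum e0); apply: filterS => n /= ne y nUy.
  have [_ _ _ _ [C [_ Cd kC]]] := mkappa n.
  apply: kC => /Cd xy; apply: nUy; apply: eU; rewrite -ball_normE/=.
  exact: lt_trans ne.
have kbd n : exists C, forall z, `|k n z| <= C.
  by have [C kC] := mollifier_bounded n mkappa; exists C => z; exact: kC.
have GI : setI_closed (@open (R3 R)) by exact: openI.
have fosc := @osc_cvg0_integrable _ _ _ (lebesgue3_sf R) (@open (R3 R)) k
  measurable3_open GI mk k0 ksym k1 kloc Omega f oOmega Omega_fin fi f0.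
exact: (@kernel_pairing_cvg _ _ _ (lebesgue3_sf R) k mk k0 k1 kbd g f M gi fi gM fosc).
Qed.

Lemma mollify_cvgC :
  \int[mu]_y (g y * \int[mu]_x (f x * kappa n ((x : R3 R) - y))) @[n --> \oo]
  --> \int[mu]_x (g x * f x).
Proof.
apply: cvg_trans mollify_cvg; apply: near_eq_cvg; apply: nearW => n.
apply: eq_Rintegral => y _; congr (_ * _).
apply: eq_Rintegral => x _; congr (_ * _).
by have [_ _ kN _ _] := mkappa n; rewrite -kN opprB.
Qed.
End mollify_cvg.

Section weak_product.
Variables (Omega : set (R3 R)) (F Dv : 'I_3 -> T3 R -> R) (g v : T3 R -> R) (M : R).
Hypotheses (oOmega : open Omega) (Omega_fin : (mu Omega < +oo)%E).
Hypotheses (mF : forall j, measurable_fun setT (F j))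
  (FM : forall j x, `|F j x| <= M) (F0 : forall j x, ~ Omega x -> F j x = 0).
Hypotheses (gi : mu.-integrable setT (EFin \o g))
  (g0 : forall x, ~ Omega x -> g x = 0).
Hypotheses (mv : measurable_fun setT v)
  (vM : forall x, `|v x| <= M) (v0 : forall x, ~ Omega x -> v x = 0).
Hypotheses (Dvi : forall j, mu.-integrable setT (EFin \o Dv j))
  (Dv0 : forall j x, ~ Omega x -> Dv j x = 0).
Hypothesis divF : forall phi, test_function Omega phi ->
  \sum_(j < 3) \int[mu]_x (F j x * partial j phi x) = - \int[mu]_x (g x * phi x).
Hypothesis gradv : forall j phi, test_function Omega phi ->
  \int[mu]_x (v x * partial j phi x) = - \int[mu]_x (Dv j x * phi x).

(* Testing div F = g with x |-> phi x * kappa (x - y), multiplying by v y and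
   integrating in y leaves only derivatives of kappa (x - y) against v y, which
   the weak derivative of v absorbs: no differentiation under the integral. *)
Lemma weak_product phi : test_function Omega phi ->
  \sum_(j < 3) \int[mu]_x (F j x * phi x * Dv j x) +
  \sum_(j < 3) \int[mu]_x (v x * (F j x * partial j phi x)) +
  \int[mu]_x (v x * (g x * phi x)) = 0.
Proof.
move=> tphi; have sphi : smooth phi by case: tphi.
have [K [cK KO phi0]] := test_function_support tphi.
(* The mollifiers are built from [phi], so the zero function is treated apart. *)
have [[x0 px0]|nphi] := pselect (exists x0, phi x0 != 0); last first.
  have pE : phi = cst 0.
    by apply/funext => x; apply/eqP/negPn/negP => px; apply: nphi; exists x.
  rewrite !big1 ?Rintegral_eq0 ?addr0// => [x|j _|j _].
  - by rewrite pE mulr0 mulr0.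
  - by apply: Rintegral_eq0 => x; rewrite pE /partial derive_cst !mulr0.
  - by apply: Rintegral_eq0 => x; rewrite pE mulr0 mul0r.
have [kappa mkappa] := mollifiers_exist sphi cK phi0 px0.
have [del del0 Kdel] := compact_margin cK oOmega KO.
have mOmega := open_measurable3 oOmega.
have Fi j : mu.-integrable setT (EFin \o F j).
  exact: (bounded_support_integrable (mF j) mOmega Omega_fin (FM j) (F0 j)).
have vi : mu.-integrable setT (EFin \o v).
  exact: (bounded_support_integrable mv mOmega Omega_fin vM v0).
have [M1 phiM] := compact_support_bounded (smooth_continuous sphi) cK phi0.
have mphi := continuous_measurable3 (smooth_continuous sphi).
have cp j : continuous (partial j phi) by exact/smooth_continuous/smooth_partial.
have p0 j x : ~ K x -> partial j phi x = 0.
  exact: (@partial_support R j phi K (compact_closed3 cK) phi0).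
have Fphi j : mu.-integrable setT (EFin \o (fun x => F j x * phi x)).
  exact: (integrable_mulr_bounded (Fi j) mphi phiM).
have Fp j : mu.-integrable setT (EFin \o (fun x => F j x * partial j phi x)).
  have [M2 pM] := compact_support_bounded (cp j) cK (p0 j).
  exact: (integrable_mulr_bounded (Fi j) (continuous_measurable3 (cp j)) pM).
have gphi : mu.-integrable setT (EFin \o (fun x => g x * phi x)).
  exact: (integrable_mulr_bounded gi mphi phiM).
pose k n (x y : T3 R) := kappa n ((x : R3 R) - y).
pose P j n := \int[mu]_x (F j x * phi x * \int[mu]_y (Dv j y * k n x y)).
pose Q j n := \int[mu]_y (v y * \int[mu]_x (F j x * partial j phi x * k n x y)).
pose S n := \int[mu]_y (v y * \int[mu]_x (g x * phi x * k n x y)).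
have cP j : P j n @[n --> \oo] --> \int[mu]_x (F j x * phi x * Dv j x).
  apply: (mollify_cvg mkappa oOmega Omega_fin (Dvi j) (Fphi j) (M := M * M1)) => // x.
    by rewrite normrM ler_pM.
  exact: Dv0.
have cQ j : Q j n @[n --> \oo] --> \int[mu]_x (v x * (F j x * partial j phi x)).
  apply: (mollify_cvgC mkappa oOmega Omega_fin (Fp j) vi vM) => x nOx.
  by rewrite F0// mul0r.
have cS : S n @[n --> \oo] --> \int[mu]_x (v x * (g x * phi x)).
  apply: (mollify_cvgC mkappa oOmega Omega_fin gphi vi vM) => x nOx.
  by rewrite g0// mul0r.
have cvgPQS : (\sum_(j < 3) P j n + \sum_(j < 3) Q j n + S n) @[n --> \oo] -->
    \sum_(j < 3) \int[mu]_x (F j x * phi x * Dv j x) +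
    \sum_(j < 3) \int[mu]_x (v x * (F j x * partial j phi x)) +
    \int[mu]_x (v x * (g x * phi x)).
  by apply: cvgD => //; apply: cvgD; exact: cvg_sumr.
(* The regularised identity is exact, not approximate, as soon as the mollifier is narrower than the
   margin [del] of [K] in Omega. *)
suff PQS0 : \forall n \near \oo, \sum_(j < 3) P j n + \sum_(j < 3) Q j n + S n = 0.
  exact: (cvg_unique (@Rhausdorff R) cvgPQS (cvg_near_cst _ PQS0)).
have := near_infty_natSinv_lt (PosNum del0); apply: filterS => n /= ndel.
have [sk _ _ _ [C [cC Cd kC0]]] := mkappa n.
have ck := smooth_continuous sk.
have [Ck kCk] := mollifier_bounded n mkappa.
have sdk j : smooth (partial j (kappa n)) by exact: smooth_partial.
have cdk j := smooth_continuous (sdk j).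
have dkC j : exists M2, forall h, `|partial j (kappa n) h| <= M2.
  exact: compact_support_bounded (cdk j) cC
    (@partial_support R j _ C (compact_closed3 cC) kC0).
pose A j y := \int[mu]_x (F j x * phi x * partial j (kappa n) ((x : R3 R) - y)).
pose B j y := \int[mu]_x (F j x * partial j phi x * kappa n ((x : R3 R) - y)).
pose G y := \int[mu]_x (g x * phi x * kappa n ((x : R3 R) - y)).
(* The derivative of [phi x * kappa n (x - y)] splits into the part falling on the mollifier, [A],
   and the part falling on [phi], [B]. *)
have ABG y : \sum_(j < 3) A j y + \sum_(j < 3) B j y + G y = 0.
  have sky : smooth (fun x : R3 R => kappa n (1 *: x + - y)) by exact: smooth_affine.
  have := divF (test_functionM tphi sky); rewrite -big_split/= => H.
  apply/eqP; rewrite addr_eq0; apply/eqP.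
  transitivity (- \int[mu]_x (g x * (phi x * kappa n (1 *: (x : R3 R) + - y)))).
    rewrite -H; apply: eq_bigr => j _; rewrite /A /B.
    have [M2 dkM] := dkC j.
    rewrite -RintegralD//; last 2 first.
    - exact: (integrable_conv_inner (cdk j) dkM (Fphi j)).
    - exact: (integrable_conv_inner ck kCk (Fp j)).
    apply: eq_Rintegral => x _.
    by rewrite partialM// partial_affine// mul1r scale1r; ring.
  by congr (- _); apply: eq_Rintegral => x _; rewrite scale1r mulrA.
have vA j : mu.-integrable setT (EFin \o (fun y => v y * A j y)).
  have [M2 dkM] := dkC j.
  exact: (integrable_conv (cdk j) dkM vi (Fphi j)).
have vB j : mu.-integrable setT (EFin \o (fun y => v y * B j y)).
  exact: (integrable_conv ck kCk vi (Fp j)).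
have vG : mu.-integrable setT (EFin \o (fun y => v y * G y)).
  exact: (integrable_conv ck kCk vi gphi).
(* After Fubini the inner integral pairs [v] with a derivative of the mollifier at [x - y]. The
   derivative in y is the opposite of the one in x; this sign cancels that of the weak derivative,
   which moves onto [v]. *)
have PE j : P j n = \int[mu]_y (v y * A j y).
  have [M2 dkM] := dkC j.
  rewrite /A (conv_fubini (cdk j) dkM vi (Fphi j)) /P.
  apply: eq_Rintegral => x _.
  have [Kx|nKx] := pselect (K x); last by rewrite phi0// mulr0 !mul0r.
  congr (_ * _).
  have skx : smooth (fun y : R3 R => kappa n ((-1) *: y + x)) by exact: smooth_affine.
  (* Here [x] lies in [K], so the support of y |-> [kappa n (x - y)] stays in Omega by the choice of
     [del]. Off [K] both sides vanish with [phi]. *)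
  have tk : test_function Omega (fun y : R3 R => kappa n ((-1) *: y + x)).
    apply: (test_functionP (K := (fun h : R3 R => (-1) *: h + x) @` C) skx).
    - apply: continuous_compact => //; apply: continuous_subspaceT => h.
      by apply: cvgD; [exact: scaler_continuous|exact: cvg_cst].
    - move=> _ [h Ch <-]; rewrite addrC; apply: Kdel => //.
      by rewrite scaleN1r normrN; exact: lt_trans (Cd _ Ch) ndel.
    - move=> y ny; apply: kC0 => Cy; apply: ny; exists ((-1) *: y + x) => //.
      by rewrite scalerDr scalerA mulrNN mulr1 scale1r scaleN1r subrK.
  have := gradv j tk.
  have -> : \int[mu]_y (v y * partial j (fun y : R3 R => kappa n ((-1) *: y + x)) y) =
      - \int[mu]_y (v y * partial j (kappa n) ((x : R3 R) - y)).
    rewrite -[RHS]mulN1r -RintegralZl//.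
      apply: eq_Rintegral => y _; rewrite partial_affine// scaleN1r (addrC _ x).
      by ring.
    apply: (integrable_mulr_bounded vi _ (M := M2)) => [|y]; last exact: dkM.
    have mdk := measurable_conv_kernel (cdk j).
    exact: (measurable_fun_pair2 x mdk).
  move=> /oppr_inj ->; apply: eq_Rintegral => y _.
  by rewrite /k scaleN1r addrC.
rewrite (eq_bigr _ (fun j _ => PE j)).
rewrite -!Rintegral_sum//.
have svA := integrable_Rsum (index_enum 'I_3) vA.
have svB := integrable_Rsum (index_enum 'I_3) vB.
rewrite -RintegralD// -RintegralD//; last first.
  by have := integrableD measurableT svA svB; apply: eq_integrable.
apply: Rintegral_eq0 => y.
transitivity (v y * (\sum_(j < 3) A j y + \sum_(j < 3) B j y + G y)).
  by rewrite !mulrDr !mulr_sumr.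
by rewrite ABG mulr0.
Qed.

End weak_product.

(* The fundamental lemma of the calculus of variations, in the form of an
   extension of the class of test functions. *)
Lemma weak_zero_bounded (Omega : set (R3 R)) (h b : T3 R -> R) (M : R) :
  open Omega -> (mu Omega < +oo)%E ->
  mu.-integrable setT (EFin \o h) -> (forall x, ~ Omega x -> h x = 0) ->
  measurable_fun setT b -> (forall x, `|b x| <= M) ->
  (forall x, ~ Omega x -> b x = 0) ->
  (forall phi, test_function Omega phi -> \int[mu]_x (h x * phi x) = 0) ->
  forall phi, test_function Omega phi -> \int[mu]_x (b x * (h x * phi x)) = 0.
Proof.
move=> oOmega Omega_fin hi h0 mb bM b0 hphi phi tphi.
have sphi : smooth phi by case: tphi.
have [K [cK KO phi0]] := test_function_support tphi.
have [[x0 px0]|nphi] := pselect (exists x0, phi x0 != 0); last first.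
  apply: Rintegral_eq0 => x; suff -> : phi x = 0 by rewrite !mulr0.
  by apply/eqP/negPn/negP => px; apply: nphi; exists x.
have [kappa mkappa] := mollifiers_exist sphi cK phi0 px0.
have bi : mu.-integrable setT (EFin \o b).
  exact: (bounded_support_integrable mb (open_measurable3 oOmega) Omega_fin bM b0).
have [M1 phiM] := compact_support_bounded (smooth_continuous sphi) cK phi0.
have hphii : mu.-integrable setT (EFin \o (fun x => h x * phi x)).
  have mphi := continuous_measurable3 (smooth_continuous sphi).
  exact: (integrable_mulr_bounded hi mphi phiM).
have hphi0 x : ~ Omega x -> h x * phi x = 0 by move=> /h0 ->; rewrite mul0r.
have cvgB := mollify_cvgC mkappa oOmega Omega_fin hphii bi bM hphi0.
suff B0 : \forall n \near \oo,
    \int[mu]_y (b y * \int[mu]_x (h x * phi x * kappa n ((x : R3 R) - y))) = 0.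
  exact: (cvg_unique (@Rhausdorff R) cvgB (cvg_near_cst _ B0)).
(* For fixed y the function x |-> [phi x * kappa n (x - y)] is itself a test function, so the inner
   integral is 0 for every [n]. *)
apply: nearW => n; apply: Rintegral_eq0 => y.
have [sk _ _ _ _] := mkappa n.
have sky : smooth (fun x : R3 R => kappa n (1 *: x + - y)) by exact: smooth_affine.
rewrite -[RHS](mulr0 (b y)); congr (_ * _).
rewrite -(hphi _ (test_functionM tphi sky)).
by apply: eq_Rintegral => x _; rewrite scale1r mulrA.
Qed.

End mollification.

(** * Divergence identities *)

#[local] Instance ae_lebesgue3_filter (R : realType) :
  Filter (nbhs (almost_everywhere (lebesgue3 R))).
Proof. exact: ae_filter_ringOfSetsType. Qed.

(** * Representatives that are bounded everywhere *)

Section ae_representatives.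
Context {R : realType}.
Local Notation mu := (lebesgue3 R).
Variable Omega : set (R3 R).
Hypotheses (oOmega : open Omega) (Omega_fin : (mu Omega < +oo)%E).

Let mOmega : measurable (Omega : set (T3 R)) := open_measurable3 oOmega.

Lemma Linfty_ae_bounded (f : R3 R -> R) : in_Lp Omega +oo f ->
  measurable_fun (Omega : set (T3 R)) (f : T3 R -> R) /\
  exists M, {ae mu, forall x, Omega x -> `|f x| <= M}.
Proof.
rewrite /in_Lp inE => /andP[/[!inE]/= mf].
rewrite /finite_norm unlock => fM.
split; first exact/(measurable_restrictT _ mOmega).
(* The norm of infinite exponent is the essential supremum provided that the whole space has
   positive measure. *)
have mu0 : (0 < mu setT)%E.
  apply: (@lt_le_trans _ _ (mu (ball (0 : R3 R) 1))).
    by rewrite lebesgue3_ball// lte_fin exprn_gt0.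
  by apply: le_measure; rewrite ?inE//; exact: measurable_ball3.
rewrite mu0 in fM.
have [M] : exists M, (ess_sup mu (abse \o (EFin \o f \_ Omega)) <= M%:E)%E.
  move: fM; case: (ess_sup _ _) => [r _||_]; first by exists r.
    by rewrite ltxx.
  by exists 0; rewrite leNye.
move=> /ess_supP H; exists M; apply: filterS H => x /= + Ox.
by rewrite lee_fin patchE mem_set.
Qed.

(** Truncating the extension by 0 at levels [- M] and [M] changes it on a null set only. The kernel
    lemmas ask for bounds at every point, which this provides. *)
Lemma bounded_representative (f : R3 R -> R) M :
  measurable_fun (Omega : set (T3 R)) (f : T3 R -> R) ->
  0 <= M -> {ae mu, forall x, Omega x -> `|f x| <= M} ->
  exists f' : T3 R -> R, [/\ measurable_fun setT f', forall x, `|f' x| <= M,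
    forall x, ~ Omega x -> f' x = 0 &
    {ae mu, forall x, Omega x -> f x = f' x}].
Proof.
move=> mf M0 fM; have /(measurable_restrictT _ mOmega) mfr := mf.
exists (fun x => Num.max (- M) (Num.min M ((f \_ Omega) x))); split.
- by apply: measurable_maxr => //; exact: measurable_minr.
- move=> x; rewrite ler_norml le_max lexx/= ge_max ge_min lexx/= andbT.
  by rewrite -subr_ge0 opprK addr_ge0.
- move=> x nOx; rewrite patchE memNset// (min_idPr _)// (max_idPr _)//.
  by rewrite oppr_le0.
- apply: filterS fM => x + Ox; move=> /(_ Ox); rewrite ler_norml => /andP[Mf fM].
  by rewrite patchE mem_set// (min_idPr _)// (max_idPr _).
Qed.

Lemma Rintegral_representative (f : R3 R -> R) (f' : T3 R -> R) :
  measurable_fun (Omega : set (T3 R)) (f : T3 R -> R) ->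
  measurable_fun setT f' -> (forall x, ~ Omega x -> f' x = 0) ->
  {ae mu, forall x, Omega x -> f x = f' x} ->
  \int[mu]_(x in Omega) f x = \int[mu]_x f' x.
Proof.
move=> mf mf' f'0 ff'.
have -> : \int[mu]_x f' x = \int[mu]_(x in Omega) f' x.
  rewrite [RHS]Rintegral_mkcond; apply: eq_Rintegral => x _; rewrite patchE.
  by case: ifPn => // /negP nOx; rewrite f'0// => /mem_set.
congr fine; apply: ae_eq_integral => //.
- exact/measurable_EFinP.
- by apply/measurable_EFinP; exact: measurable_funTS.
- by apply: filterS ff' => x H /H ->.
Qed.

Lemma Rintegral_ae_eq (f g : T3 R -> R) :
  measurable_fun setT f -> measurable_fun setT g ->
  (forall x, ~ Omega x -> f x = g x) ->
  {ae mu, forall x, Omega x -> f x = g x} ->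
  \int[mu]_x f x = \int[mu]_x g x.
Proof.
move=> mf mg fg0 fg; congr fine; apply: ae_eq_integral => //.
- exact/measurable_EFinP.
- exact/measurable_EFinP.
- apply: filterS fg => x H _; congr EFin.
  by have [/H//|/fg0] := pselect (Omega x).
Qed.

Lemma loc_integrable_representative (f : R3 R -> R) (f' : T3 R -> R) :
  measurable_fun (Omega : set (T3 R)) (f : T3 R -> R) ->
  mu.-integrable setT (EFin \o f') ->
  {ae mu, forall x, Omega x -> f x = f' x} -> loc_integrable Omega f.
Proof.
move=> mf f'i ff' K cK KO; have mK := compact_measurable3 cK.
have mfK : measurable_fun (K : set (T3 R)) (EFin \o f).
  by apply/measurable_EFinP; exact: measurable_funS mf.
have /integrableP[mf' f'fin] := integrableS measurableT mK (@subsetT _ _) f'i.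
apply/integrableP; split => //.
rewrite (@ae_eq_integral _ _ _ _ _ (fun x => `|(EFin \o f') x|)%E)//.
- exact: measurableT_comp.
- exact: measurableT_comp.
- by apply: filterS ff' => x H /KO/H /= ->.
Qed.

End ae_representatives.

Lemma enorm1_dot (R : realType) (u : 'rV[R]_3) : enorm u = 1 -> dot u u = 1.
Proof.
have d0 : 0 <= dot u u by rewrite /dot sumr_ge0// => i _; rewrite -expr2 sqr_ge0.
by rewrite /enorm => /(congr1 (fun x => x ^+ 2)); rewrite sqr_sqrtr// expr1n.
Qed.

Lemma enorm1_coord (R : realType) (u : 'rV[R]_3) i : enorm u = 1 -> `|u 0 i| <= 1.
Proof.
move=> /enorm1_dot u1; rewrite -(@ler_pXn2r _ 2)// ?nnegrE// expr1n.
rewrite real_normK ?num_real// -u1 /dot (bigD1 i)//= -expr2 lerDl.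
by rewrite sumr_ge0// => j _; rewrite -expr2 sqr_ge0.
Qed.

Section test_function_extra.
Context {R : realType}.
Local Notation mu := (lebesgue3 R).
Variable Omega : set (R3 R).
Implicit Type phi : R3 R -> R.

Lemma test_function_partial i phi :
  test_function Omega phi -> test_function Omega (partial i phi).
Proof.
move=> tphi; have [K [cK KO phi0]] := test_function_support tphi.
apply: (test_functionP _ cK KO); first by apply: smooth_partial; case: tphi.
exact: (@partial_support R i phi K (compact_closed3 cK) phi0).
Qed.

Lemma test_function_measurable phi : test_function Omega phi ->
  measurable_fun setT (phi : T3 R -> R).
Proof. by move=> [sphi _ _]; exact: continuous_measurable3 (smooth_continuous sphi). Qed.

Lemma test_function_eq0 phi x : test_function Omega phi -> ~ Omega x -> phi x = 0.
Proof.
move=> /test_function_support[K [_ KO phi0]] nOx.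
by apply: phi0 => /KO.
Qed.

Lemma integrableM_test (f : T3 R -> R) phi : mu.-integrable setT (EFin \o f) ->
  test_function Omega phi -> mu.-integrable setT (EFin \o (fun x => f x * phi x)).
Proof.
move=> fi tphi; have [K [cK KO phi0]] := test_function_support tphi.
have [sphi _ _] := tphi.
have [C phiC] := compact_support_bounded (smooth_continuous sphi) cK phi0.
exact: integrable_mulr_bounded fi (test_function_measurable tphi) phiC.
Qed.

Lemma test_function_integrable phi : test_function Omega phi ->
  mu.-integrable setT (EFin \o phi).
Proof.
move=> tphi; have [K [cK KO phi0]] := test_function_support tphi.
have [sphi _ _] := tphi.
exact: compact_support_integrable (smooth_continuous sphi) cK phi0.
Qed.

Lemma integral_partial_test i phi : test_function Omega phi ->
  \int[mu]_x partial i phi x = 0.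
Proof.
move=> tphi; have [K [cK KO phi0]] := test_function_support tphi.
by apply: (@integral_partial0 R i phi K) => //; case: tphi.
Qed.

End test_function_extra.

Section divergence.
Context {R : realType}.
Local Notation mu := (lebesgue3 R).
Variables (Omega : set (R3 R)) (d : 'I_3 -> 'I_3 -> T3 R -> R) (M : R).
Hypotheses (oOmega : open Omega) (Omega_fin : (mu Omega < +oo)%E) (M0 : 0 <= M).
Hypotheses (md : forall i j, measurable_fun setT (d i j))
  (dM : forall i j x, `|d i j x| <= M)
  (d0 : forall i j x, ~ Omega x -> d i j x = 0).

Let mO : measurable (Omega : set (T3 R)) := open_measurable3 oOmega.

Let di i j : mu.-integrable setT (EFin \o d i j).
Proof. exact: (bounded_support_integrable (md i j) mO Omega_fin (dM i j) (@d0 i j)). Qed.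

(* The gradient d of z satisfies [div (d^T) = grad (tr d)], by symmetry of the
   second derivatives of the test function. *)
Lemma div_transpose_gradient (z : 'I_3 -> R3 R -> R) (c : R) :
  (forall i j phi, test_function Omega phi ->
     \int[mu]_(x in Omega) (z i x * partial j phi x) = - \int[mu]_x (d i j x * phi x)) ->
  {ae mu, forall x, Omega x -> \sum_(j < 3) d j j x = c} ->
  forall i phi, test_function Omega phi ->
    \sum_(j < 3) \int[mu]_x (d j i x * partial j phi x) = 0.
Proof.
move=> gradz trd i phi tphi; have sphi : smooth phi by case: tphi.
have tp j := test_function_partial j tphi.
(* Testing with derivatives of [phi], both sides equal minus the integral of [z j] against the same
   mixed second derivative. *)
have swap j : \int[mu]_x (d j i x * partial j phi x) =
    \int[mu]_x (d j j x * partial i phi x).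
  apply: oppr_inj.
  refine (eq_trans (esym (gradz j i _ (tp j))) (eq_trans _ (gradz j j _ (tp i)))).
  by apply: eq_Rintegral => x _; rewrite partialC.
under eq_bigr do rewrite swap.
rewrite -(@Rintegral_sum _ _ _ mu _ _
  (fun j x => d j j x * partial i phi x)); last first.
  by move=> j; exact: (integrableM_test (di j j) (tp i)).
have mp := test_function_measurable (tp i).
transitivity (\int[mu]_x (c * partial i phi x)).
  apply: (Rintegral_ae_eq (Omega := Omega)).
  - by apply: measurable_sum => j; exact: measurable_funM.
  - exact: measurable_funM.
  - move=> x nOx; rewrite (test_function_eq0 (tp i) nOx).
    by rewrite mulr0 big1// => j _; rewrite mulr0.
  - by apply: filterS trd => x E Ox; rewrite -mulr_suml E.
rewrite RintegralZl//; last exact: (test_function_integrable (tp i)).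
by rewrite (integral_partial_test i tphi) mulr0.
Qed.

Variables (n : 'I_3 -> T3 R -> R) (Dn : 'I_3 -> 'I_3 -> T3 R -> R).
Hypotheses (mn : forall i, measurable_fun setT (n i))
  (nM : forall i x, `|n i x| <= 1) (n0 : forall i x, ~ Omega x -> n i x = 0).
Hypotheses (Dni : forall i j, mu.-integrable setT (EFin \o Dn i j))
  (Dn0 : forall i j x, ~ Omega x -> Dn i j x = 0).
Hypothesis gradn : forall i j phi, test_function Omega phi ->
  \int[mu]_x (n i x * partial j phi x) = - \int[mu]_x (Dn i j x * phi x).
Hypothesis unit_n : {ae mu, forall x, Omega x -> \sum_(i < 3) n i x * n i x = 1}.

Let integrable_bounded_mull (c f : T3 R -> R) C : measurable_fun setT c ->
  (forall x, `|c x| <= C) -> mu.-integrable setT (EFin \o f) ->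
  mu.-integrable setT (EFin \o (fun x => c x * f x)).
Proof.
move=> mc cC fi; have := integrable_mulr_bounded fi mc cC.
by apply: eq_integrable => // x _ /=; rewrite mulrC.
Qed.

Let h j x := \sum_(i < 3) n i x * Dn i j x.

Let hi j : mu.-integrable setT (EFin \o h j).
Proof.
by apply: integrable_Rsum => i; exact: integrable_bounded_mull (mn i) (nM i) (Dni i j).
Qed.

Let h0 j x : ~ Omega x -> h j x = 0.
Proof. by move=> nOx; rewrite /h big1// => i _; rewrite n0// mul0r. Qed.

(* Half the gradient of |n|^2. *)
Lemma unit_field_gradient j phi : test_function Omega phi ->
  \int[mu]_x ((\sum_(i < 3) n i x * Dn i j x) * phi x) = 0.
Proof.
move=> tphi; have tp := test_function_partial j tphi.
have mphi := test_function_measurable tphi; have mp := test_function_measurable tp.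
pose X i := \int[mu]_x (n i x * (Dn i j x * phi x)).
pose Y i := \int[mu]_x (n i x * (n i x * partial j phi x)).
have ni i : mu.-integrable setT (EFin \o n i).
  exact: (bounded_support_integrable (mn i) mO Omega_fin (nM i) (@n0 i)).
have XY i : X i + Y i + X i = 0.
  (* The field [n i] times the j-th basis vector has divergence [Dn i j]. Taking also [n i] as the
     scalar factor, [weak_product] becomes the derivative of the square of [n i], with two equal
     terms [X i]. *)
  pose F l : T3 R -> R := if l == j then n i else cst 0.
  have F1 l : measurable_fun setT (F l) by rewrite /F; case: ifP.
  have F2 l x : `|F l x| <= 1 by rewrite /F; case: ifP => // _; rewrite normr0.
  have F3 l x : ~ Omega x -> F l x = 0 by rewrite /F; case: ifP => // _; exact: n0.
  have F4 psi : test_function Omega psi ->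
      \sum_(l < 3) \int[mu]_x (F l x * partial l psi x) = - \int[mu]_x (Dn i j x * psi x).
    move=> tpsi; rewrite (bigD1 j)//= big1 ?addr0; last first.
      move=> l /negbTE lj; apply: Rintegral_eq0 => x.
      by rewrite /F lj mul0r.
    by rewrite /F eqxx gradn.
  have := weak_product oOmega Omega_fin F1 F2 F3 (Dni i j) (@Dn0 i j) (mn i) (nM i)
    (@n0 i) (Dni i) (@Dn0 i) F4 (@gradn i) tphi.
  rewrite (bigD1 j)//= [X in _ + X + _ + _]big1 ?addr0; last first.
    by move=> l /negbTE lj; apply: Rintegral_eq0 => x; rewrite /F lj !mul0r.
  rewrite [X in _ + X + _](bigD1 j)//= [X in _ + (_ + X) + _]big1 ?addr0; last first.
    by move=> l /negbTE lj; apply: Rintegral_eq0 => x; rewrite /F lj mul0r mulr0.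
  move=> <-; rewrite /F eqxx; congr (_ + _ + _).
  by apply: eq_Rintegral => x _; ring.
have sumX : \sum_(i < 3) X i = \int[mu]_x (h j x * phi x).
  rewrite -(@Rintegral_sum _ _ _ mu _ _ (fun i x => n i x * (Dn i j x * phi x))).
    apply: eq_Rintegral => x _; rewrite /h mulr_suml.
    by apply: eq_bigr => i _; rewrite mulrA.
  move=> i; apply: integrable_bounded_mull (mn i) (nM i) _.
  exact: integrableM_test (Dni i j) tphi.
have sumY : \sum_(i < 3) Y i = 0.
  rewrite -(@Rintegral_sum _ _ _ mu _ _
    (fun i x => n i x * (n i x * partial j phi x))); last first.
    move=> i; apply: integrable_bounded_mull (mn i) (nM i) _.
    exact: integrableM_test (ni i) tp.
  rewrite -[RHS](integral_partial_test j tphi); apply: (Rintegral_ae_eq (Omega := Omega)).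
  - apply: measurable_sum => i; apply: measurable_funM => //.
    exact: measurable_funM.
  - exact: mp.
  - move=> x nOx; rewrite (test_function_eq0 tp nOx).
    by rewrite big1// => i _; rewrite !mulr0.
  - apply: filterS unit_n => x sq1 Ox.
    by under eq_bigr do rewrite mulrA; rewrite -mulr_suml sq1// mul1r.
have : \sum_(i < 3) (X i + Y i + X i) = 0 by rewrite big1.
rewrite !big_split/= sumY addr0 sumX => /eqP.
by rewrite -mulr2n mulrn_eq0/= => /eqP.
Qed.

(** The sum of [d j i * n i] over [i] is a_j, because n has length 1. For each [i] the product rule
    is applied to the divergence-free field formed by the [d j i], which is n_i a, and the scalar
    [n i]; summing over [i], the terms with [Dn] assemble into a . grad (|n|^2 / 2). *)
Lemma div_unit_factor :
  (forall i phi, test_function Omega phi ->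
     \sum_(j < 3) \int[mu]_x (d j i x * partial j phi x) = 0) ->
  {ae mu, forall x, Omega x ->
     forall i j, d i j x = (\sum_(l < 3) d i l x * n l x) * n j x} ->
  forall phi, test_function Omega phi ->
    \sum_(j < 3) \int[mu]_x ((\sum_(i < 3) d j i x * n i x) * partial j phi x) = 0.
Proof.
move=> divd dE phi tphi; have mphi := test_function_measurable tphi.
pose a j x := \sum_(i < 3) d j i x * n i x.
have ma j : measurable_fun setT (a j).
  by apply: measurable_sum => i; exact: measurable_funM.
have a0 j x : ~ Omega x -> a j x = 0.
  by move=> nOx; rewrite /a big1// => i _; rewrite d0// mul0r.
have aM j x : `|a j x| <= \sum_(i < 3) M.
  apply: le_trans (ler_norm_sum _ _ _) _; apply: ler_sum => i _.
  by rewrite normrM -[leRHS]mulr1 ler_pM.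
have W i : \sum_(j < 3) \int[mu]_x (d j i x * phi x * Dn i j x) +
    \sum_(j < 3) \int[mu]_x (n i x * (d j i x * partial j phi x)) = 0.
  (* [weak_product] takes one bound for field and scalar; [M + 1] dominates both [M] and 1. *)
  have dM1 j x : `|d j i x| <= M + 1 by rewrite (le_trans (dM j i x))// lerDl.
  have nM1 x : `|n i x| <= M + 1 by rewrite (le_trans (nM i x))// lerDr.
  have F4 psi : test_function Omega psi ->
      \sum_(l < 3) \int[mu]_x (d l i x * partial l psi x) = - \int[mu]_x (cst 0 x * psi x).
    move=> tpsi; rewrite divd// Rintegral_eq0 ?oppr0// => x.
    by rewrite mul0r.
  have c0 : mu.-integrable setT (EFin \o (cst 0 : T3 R -> R)) by exact: integrable0.
  have := weak_product oOmega Omega_fin (fun j => md j i) dM1 (fun j => @d0 j i) c0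
    (fun _ _ => erefl) (mn i) nM1 (@n0 i) (Dni i) (@Dn0 i) F4 (@gradn i) tphi.
  rewrite [X in _ + X]Rintegral_eq0 ?addr0// => x.
  by rewrite mul0r mulr0.
have : \sum_(i < 3) (\sum_(j < 3) \int[mu]_x (d j i x * phi x * Dn i j x) +
    \sum_(j < 3) \int[mu]_x (n i x * (d j i x * partial j phi x))) = 0.
  by rewrite big1.
rewrite big_split/= exchange_big/= [X in _ + X]exchange_big/=.
rewrite big1 ?add0r; last first.
  move=> j _.
  rewrite -(@Rintegral_sum _ _ _ mu _ _
    (fun i x => d j i x * phi x * Dn i j x)); last first.
    move=> i.
    have := integrable_bounded_mull (md j i) (dM j i) (integrableM_test (Dni i j) tphi).
    by apply: eq_integrable => // x _ /=; congr EFin; ring.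
  (* By the rank-one form of [d] the sum over [i] is [a j * h j * phi]. As [a j] is only bounded and
     measurable, [a j * phi] cannot serve as a test function, and the extended class of multipliers
     is used. *)
  rewrite -[RHS](weak_zero_bounded oOmega Omega_fin (hi j) (@h0 j) (ma j) (aM j) (@a0 j)
    (@unit_field_gradient j) tphi).
  apply: (Rintegral_ae_eq (Omega := Omega)).
  - apply: measurable_sum => i; apply: measurable_funM; first exact: measurable_funM.
    by apply/measurable_EFinP; exact: measurable_int (Dni i j).
  - apply: measurable_funM => //; apply: measurable_funM => //.
    by apply/measurable_EFinP; exact: measurable_int (hi j).
  - move=> x nOx; rewrite a0// mul0r big1// => i _.
    by rewrite d0// !mul0r.
  - apply: filterS dE => x E Ox.
    rewrite /h [_ * phi x]mulr_suml mulr_sumr; apply: eq_bigr => i _.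
    by rewrite E// -/(a j x); ring.
move=> H; rewrite -[RHS]H; apply: eq_bigr => j _.
rewrite -(@Rintegral_sum _ _ _ mu _ _
  (fun i x => n i x * (d j i x * partial j phi x))); last first.
  move=> i; apply: integrable_bounded_mull (mn i) (nM i) _.
  exact: integrableM_test (di j i) (test_function_partial j tphi).
apply: eq_Rintegral => x _; rewrite mulr_suml; apply: eq_bigr => i _.
by ring.
Qed.

End divergence.

(** The way back from representatives on R^3 to the field on Omega: the divergence as well as the
    local integrability in [distr_div_eq0] only depend on the class almost everywhere. *)
Lemma distr_div_eq0_representative (R : realType) (Omega : set (R3 R))
    (v : R3 R -> 'rV[R]_3) (v' : 'I_3 -> T3 R -> R) :
  open Omega -> measurable_field Omega v ->
  (forall j, (lebesgue3 R).-integrable setT (EFin \o v' j)) ->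
  (forall j x, ~ Omega x -> v' j x = 0) ->
  {ae lebesgue3 R, forall x, Omega x -> forall j, v x 0 j = v' j x} ->
  (forall phi, test_function Omega phi ->
     \sum_(j < 3) \int[lebesgue3 R]_x (v' j x * partial j phi x) = 0) ->
  distr_div_eq0 Omega v.
Proof.
move=> oOmega mv v'i v'0 vE divv; split => [j|phi tphi].
  apply: (loc_integrable_representative oOmega _ (v'i j)); first exact: mv.
  by apply: filterS vE => x E Ox; rewrite E.
have tp j := test_function_partial j tphi.
have mp j := test_function_measurable (tp j).
rewrite /distr_div; apply/eqP; rewrite oppr_eq0; apply/eqP; rewrite -[RHS](divv phi tphi).
rewrite -(@Rintegral_sum _ _ _ (lebesgue3 R) _ _
  (fun j x => v' j x * partial j phi x)); last first.
  by move=> j; exact: integrableM_test (v'i j) (tp j).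
apply: Rintegral_representative => //.
- apply: measurable_sum => j; apply: measurable_funM; first exact: mv.
  exact: measurable_funTS.
- apply: measurable_sum => j; apply: measurable_funM => //.
  by apply/measurable_EFinP; exact: measurable_int (v'i j).
- by move=> x nOx; rewrite big1// => j _; rewrite v'0// mul0r.
- apply: filterS vE => x E Ox; apply: eq_bigr => j _.
  by rewrite E.
Qed.

Unset Implicit Arguments.
Set Strict Implicit.

Theorem proposition5p2 (R : realType) (Omega : set (R3 R))
    (z a n : R3 R -> 'rV[R]_3) (Dz : R3 R -> 'M[R]_3) (D : R)
    (Omega_open : open Omega)
    (Omega_bounded : bounded_set Omega)
    (Omega_connected : connected Omega)
    (Omega_Lipschitz : Lipschitz_boundary Omega)
    (z_W1oo : in_W1p_with_gradient Omega +oo%E z Dz)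
    (a_meas : measurable_field Omega a)
    (n_meas : measurable_field Omega n)
    (Dz_eq : {ae lebesgue3 R, forall x, Omega x -> Dz x = outer (a x) (n x)})
    (dot_an : {ae lebesgue3 R, forall x, Omega x -> dot (a x) (n x) = D - 1}) :
  distr_row_div_eq0 Omega (fun x => outer (n x) (a x)) /\
  (in_W1p Omega 1%E n ->
   {ae lebesgue3 R, forall x, Omega x -> enorm (n x) = 1} ->
   distr_div_eq0 Omega a).
Proof.
set mu := lebesgue3 R.
have mO := open_measurable3 Omega_open.
have Ofin : (mu Omega < +oo)%E by exact: lebesgue3_bounded_lty.
have [gradz _ Dz_oo] := z_W1oo.
have mDz i j : measurable_fun (Omega : set (T3 R)) (fun x : T3 R => Dz x i j).
  by have [] := Linfty_ae_bounded Omega_open (Dz_oo i j).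
have [M M0 DzM] : exists2 M, 0 <= M &
    forall i j, {ae mu, forall x, Omega x -> `|Dz x i j| <= M}.
  have H (p : 'I_3 * 'I_3) : exists M, {ae mu, forall x, Omega x -> `|Dz x p.1 p.2| <= M}.
    by have [_] := Linfty_ae_bounded Omega_open (Dz_oo p.1 p.2).
  have [Mp HM] := choice H.
  (* One bound for the nine entries. The absolute values matter: a bound that holds almost
     everywhere on a null set could be negative. *)
  exists (\sum_p `|Mp p|) => [|i j]; first by rewrite sumr_ge0.
  apply: filterS (HM (i, j)) => x + Ox; move=> /(_ Ox)/le_trans; apply.
  by rewrite (le_trans (ler_norm _))// (bigD1 (i, j))//= lerDl sumr_ge0.
have [d dP] := choice (fun p : 'I_3 * 'I_3 =>
  bounded_representative Omega_open (mDz p.1 p.2) M0 (DzM p.1 p.2)).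
pose d' i j := d (i, j).
have md i j : measurable_fun setT (d' i j) by have [] := dP (i, j).
have dM i j x : `|d' i j x| <= M by have [_ + _ _] := dP (i, j); apply.
have d0 i j x : ~ Omega x -> d' i j x = 0 by have [_ _ + _] := dP (i, j); apply.
have dE i j : {ae mu, forall x, Omega x -> Dz x i j = d' i j x} by have [] := dP (i, j).
have di i j : mu.-integrable setT (EFin \o d' i j).
  exact: (bounded_support_integrable (md i j) mO Ofin (dM i j) (d0 i j)).
have dan : {ae mu, forall x, Omega x -> forall i j, d' i j x = a x 0 i * n x 0 j}.
  have dE' : {ae mu, forall x i j, Omega x -> Dz x i j = d' i j x}.
    by apply: filter_forall => i; exact: filter_forall.
  apply: filterS2 dE' Dz_eq => x E E' Ox i j.
  by rewrite -E// E'// mxE.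
have gradd i j phi : test_function Omega phi ->
    \int[mu]_(x in Omega) (z x 0 i * partial j phi x) = - \int[mu]_x (d' i j x * phi x).
  move=> tphi; have [_ _ /(_ phi tphi) ->] := gradz i j; congr (- _).
  have mphi := test_function_measurable tphi.
  apply: Rintegral_representative => //.
  - by apply: measurable_funM => //; exact: measurable_funTS.
  - exact: measurable_funM.
  - by move=> x /d0 ->; rewrite mul0r.
  - by apply: filterS (dE i j) => x E Ox; rewrite E.
have divd : forall i phi, test_function Omega phi ->
    \sum_(j < 3) \int[mu]_x (d' j i x * partial j phi x) = 0.
  apply: (div_transpose_gradient Omega_open Ofin md dM d0 gradd (c := D - 1)).
  apply: filterS2 dan dot_an => x E dt Ox; rewrite -dt// /dot.
  by apply: eq_bigr => j _; rewrite E.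
split=> [i|[Dn [gradn _ Dn_1]] n1].
  (* Row [i] of n (x) a is column [i] of the gradient of z, since both have entries n_i a_j. *)
  apply: (distr_div_eq0_representative Omega_open _ (fun j => di j i)) => //.
  - by move=> j; under eq_fun do rewrite !mxE; exact: measurable_funM.
  - by move=> j x; exact: d0.
  - by apply: filterS dan => x E Ox j; rewrite !mxE E// mulrC.
  - exact: divd.
have nM_ae i : {ae mu, forall x, Omega x -> `|n x 0 i| <= 1}.
  by apply: filterS n1 => x + Ox; move=> /(_ Ox)/enorm1_coord.
have [n' n'P] := choice (fun i =>
  bounded_representative Omega_open (n_meas i) ler01 (nM_ae i)).
have mn i : measurable_fun setT (n' i) by have [] := n'P i.
have nM i x : `|n' i x| <= 1 by have [_ + _ _] := n'P i; apply.
have n0 i x : ~ Omega x -> n' i x = 0 by have [_ _ + _] := n'P i; apply.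
have nE i : {ae mu, forall x, Omega x -> n x 0 i = n' i x} by have [] := n'P i.
(* The gradient of n is integrable but need not be bounded, so it is extended by 0 without
   truncation. *)
pose Dn' i j : T3 R -> R := (fun x => Dn x i j) \_ Omega.
have Dn'i i j : mu.-integrable setT (EFin \o Dn' i j).
  by apply/Lfun1_integrable; exact: Dn_1.
have Dn'0 i j x : ~ Omega x -> Dn' i j x = 0.
  by move=> nOx; rewrite /Dn' patchE memNset.
have mDn' i j : measurable_fun setT (Dn' i j).
  by apply/measurable_EFinP; exact: measurable_int (Dn'i i j).
have gradn' i j phi : test_function Omega phi ->
    \int[mu]_x (n' i x * partial j phi x) = - \int[mu]_x (Dn' i j x * phi x).
  move=> tphi; have [_ _ Hn] := gradn i j.
  have mphi := test_function_measurable tphi.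
  have mp := test_function_measurable (test_function_partial j tphi).
  transitivity (\int[mu]_(x in Omega) (n x 0 i * partial j phi x)).
    apply/esym/Rintegral_representative => //.
    - apply: measurable_funM; [exact: n_meas|exact: measurable_funTS].
    - exact: measurable_funM.
    - by move=> x nOx; rewrite n0// mul0r.
    - by apply: filterS (nE i) => x E Ox; rewrite E.
  refine (eq_trans (Hn _ tphi) _); congr (- _); apply: Rintegral_representative => //.
  - apply: measurable_funM; last exact: measurable_funTS.
    by apply/(measurable_restrictT _ mO); exact: mDn'.
  - exact: measurable_funM.
  - by move=> x nOx; rewrite Dn'0// mul0r.
  - by apply: aeW => x Ox; rewrite /Dn' patchE mem_set.
(* The bounds at hand concern the products a_j n_i. Contracting them with the unit vector n recovers
   a as a bounded field. *)
pose a' j x := \sum_(i < 3) d' j i x * n' i x.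
have good : {ae mu, forall x, Omega x -> [/\ \sum_(i < 3) n' i x * n' i x = 1,
    forall j, a x 0 j = a' j x & forall i j, d' i j x = a' i x * n' j x]}.
  have nE' : {ae mu, forall x i, Omega x -> n x 0 i = n' i x} by exact: filter_forall.
  apply: filterS3 nE' n1 dan => x E e1 dE' Ox.
  have sq1 : \sum_(i < 3) n' i x * n' i x = 1.
    by rewrite -(enorm1_dot (e1 Ox)) /dot; apply: eq_bigr => i _; rewrite E.
  have aE j : a x 0 j = a' j x.
    rewrite /a' -[LHS]mulr1 -sq1 mulr_sumr; apply: eq_bigr => i _.
    by rewrite dE'// E// mulrA.
  by split => // i j; rewrite -aE -E// dE'.
have unit_n : {ae mu, forall x, Omega x -> \sum_(i < 3) n' i x * n' i x = 1}.
  by apply: filterS good => x G Ox; have [] := G Ox.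
apply: (distr_div_eq0_representative (v' := a') Omega_open a_meas).
- move=> j; apply: integrable_Rsum => i.
  exact: integrable_mulr_bounded (di j i) (mn i) (nM i).
- by move=> j x nOx; rewrite /a' big1// => i _; rewrite d0// mul0r.
- by apply: filterS good => x G Ox; have [] := G Ox.
- apply: (div_unit_factor Omega_open Ofin M0 md dM d0 mn nM n0 Dn'i Dn'0 gradn'
    unit_n divd).
  by apply: filterS good => x G Ox; have [] := G Ox.
Qed.
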